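(* Let $A$ be an affine cellular $k$-algebra with cell chain $0=J_0\subset J_1\subset\cdots\subset J_n=A$ and cell data $(B_i,\sigma_i,\Delta_i,\psi^{(i)},\alpha_i)$ such that for every $1\le i\le n$ the determinant $\det(\psi^{(i)})$ is not a zero-divisor in $B_i$. Then the embedding $\Theta:A\to\widehat A$ of $A$ into its asymptotic algebra is weakly spectrum preserving if and only if all affine cell ideals $J_i/J_{i-1}$ (in $A/J_{i-1}$), $1\le i\le n$, are idempotent.
   Context: Conventions. $k$ is a commutative Noetherian domain. A $k$-involution is a $k$-linear anti-automorphism whose square is the identity. An affine commutative $k$-algebra is a finitely generated commutative unital $k$-algebra. The element $0$ counts as a zero-divisor. An ideal $J$ is idempotent if $J^2=J$. Affine cell ideal. Let $A$ be a unital $k$-algebra with a $k$-involution $i$. A two-sided ideal $J$ with $i(J)=J$ is an affine cell ideal if (1) there are a free $k$-module $V$ of finite rank $d\ge1$ and a nonzero affine commutative $k$-algebra $B$ with $k$-involution $\sigma$ such that $\Delta:=V\otimes_kB$ is an $A$-$B$-bimodule whose right $B$-structure is induced by the regular module $B_B$; (2) there is an $A$-$A$-bimodule isomorphism $\alpha:J\to\Delta\otimes_B\Delta'$, where $\Delta'=B\otimes_kV$ is a $B$-$A$-bimodule with left $B$-structure induced by ${}_BB$ and right $A$-structure $(b\otimes v)a:=\tau(i(a)(v\otimes b))$, $\tau$ the flip, such that, identifying $\Delta\otimes_B\Delta'$ with $V\otimes_kB\otimes_kV$, $\alpha(i(\alpha^{-1}(u\otimes b\otimes v)))=v\otimes\sigma(b)\otimes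 u$. $\Delta$ is the cell module of $J$. There is a $k$-bilinear $\psi:V\times V\to B$ with $\alpha(\alpha^{-1}(u\otimes b\otimes v)\,\alpha^{-1}(u'\otimes b'\otimes v'))=u\otimes b\psi(v,u')b'\otimes v'$. Fix a basis $v_1,\dots,v_d$ of $V$; the swich matrix is $\psi=(\psi(v_r,v_s))_{r,s}\in M_d(B)$. Identifying $v_r\otimes b\otimes v_s$ with $bE_{rs}$, $\alpha$ becomes a bijection $J\to M_d(B)$ with $\alpha(xy)=\alpha(x)\psi\alpha(y)$. $(B,\sigma,\Delta,\psi,\alpha)$ is the cell datum of $J$. Affine cellular algebra. $A$ (with $i$) is affine cellular if $A=J_1'\oplus\cdots\oplus J_n'$ as $k$-modules with $i(J_j')=J_j'$, such that the $J_j=\bigoplus_{l\le j}J_l'$ form a chain of two-sided ideals $0=J_0\subset J_1\subset\cdots\subset J_n=A$ (cell chain) and each $J_j/J_{j-1}$ is an affine cell ideal of $A/J_{j-1}$ (for the induced involution), with cell datum $(B_j,\sigma_j,\Delta_j,\psi^{(j)},\alpha_j)$; $d_j=\mathrm{rank}_{B_j}(\Delta_j)$. The asymptotic algebra is the ring $\widehat A=M_{d_n}(B_n)\times\cdots\times M_{d_1}(B_1)$ with ordinary matrix multiplication. If no $\det(\psi^{(j)})$ is a zero-divisor, $\Theta:A\to\widehat A$, $\Theta(a)=(\alpha_n(ae_n),\ldots,\alpha_1(ae_1))$ with $e_j=\alpha_j^{-1}(\mathbf I_{d_j})\in J_j/J_{j-1}$, is an injective homomorphism of $k$-algebras. Spectrum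 preserving maps (Baum–Nistor). For a not necessarily unital ring $R$, a left module $V$ is simple if $RV\ne0$ and $Rv=V$ for all $0\ne v\in V$; $\mathrm{Prim}(R)$ is the set of annihilators of simple left $R$-modules. A homomorphism $\Theta:R\to S$ of not necessarily unital $k$-algebras is spectrum preserving if for every $P\in\mathrm{Prim}(S)$ the ideal $\Theta^{-1}(P)$ is contained in a unique primitive ideal of $R$ and the resulting map $\mathrm{Prim}(S)\to\mathrm{Prim}(R)$ is a bijection. A morphism $\Theta:R\to S$ of $k$-algebras is weakly spectrum preserving if there exist increasing filtrations $0=J_0\subset J_1\subset\cdots\subset J_n=R$ and $0=I_0\subset I_1\subset\cdots\subset I_n=S$ by two-sided ideals with $\Theta(J_i)\subseteq I_i$ such that all induced morphisms $J_i/J_{i-1}\to I_i/I_{i-1}$ are spectrum preserving. *)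

(* Defs.v *)
From HB Require Import structures.
From mathcomp Require Import all_boot all_algebra.
From mathcomp Require Import boolp classical_sets.
Set Implicit Arguments.
Unset Strict Implicit.
Unset Printing Implicit Defensive.
Import GRing.Theory.
Local Open Scope ring_scope.
Local Open Scope quotient_scope.
Local Open Scope classical_set_scope.

(* So that membership in an ideal [J] can be written [J x]. *)
Identity Coercion set_to_fun : set >-> Funclass.

(** * Rings without unit, ideals and quotients *)

(* Simple modules, primitive ideals and spectrum preservation only involve the
   underlying (possibly non-unital) rings, so no [k]-structure is recorded. *)
Record rng := Rng {
  rng_sort :> zmodType;
  rmul : rng_sort -> rng_sort -> rng_sort;
  rmulA : associative rmul;
  rmulDl : left_distributive rmul +%R;
  rmulDr : right_distributive rmul +%R }.

Definition ring_rng (R : pzRingType) : rng :=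
  @Rng R *%R (@mulrA R) (@mulrDl R) (@mulrDr R).

Record rng_hom (R S : rng) := RngHom {
  hom_fun :> {additive R -> S};
  homM : forall x y, hom_fun (rmul x y) = rmul (hom_fun x) (hom_fun y) }.

(* Two-sided ideals. *)
Record ideal (R : rng) := Ideal {
  ideal_set :> set R;
  ideal0 : ideal_set 0;
  idealB : forall x y, ideal_set x -> ideal_set y -> ideal_set (x - y);
  idealMl : forall a x, ideal_set x -> ideal_set (rmul a x);
  idealMr : forall a x, ideal_set x -> ideal_set (rmul x a) }.

Section IdealPred.
Variables (R : rng) (J : ideal R).
Definition ideal_pred : {pred R} := fun x => `[< J x >].

Lemma ideal_predP x : reflect (J x) (x \in ideal_pred).
Proof. exact: asboolP. Qed.

Lemma ideal_zmod_closed : zmod_closed ideal_pred.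
Proof.
split=> [|x y /ideal_predP Jx /ideal_predP Jy]; apply/ideal_predP.
  exact: ideal0.
exact: idealB.
Qed.
HB.instance Definition _ := GRing.isZmodClosed.Build R ideal_pred ideal_zmod_closed.
End IdealPred.

(* [J ^ 2 = J], where [J ^ 2] consists of the finite sums of products. *)
Definition ideal_sqr (R : rng) (J : ideal R) : set R :=
  [set x | exists2 s : seq (R * R),
     forall p, p \in s -> J p.1 /\ J p.2
   & x = \sum_(p <- s) rmul p.1 p.2].

Definition idempotent_ideal (R : rng) (J : ideal R) := ideal_sqr J = J.

Section SubRng.
Variables (R : rng) (J : ideal R).

Definition ideal_sub := {x : R | x \in ideal_pred J}.
HB.instance Definition _ := SubChoice.on ideal_sub.
HB.instance Definition _ := [SubChoice_isSubZmodule of ideal_sub by <:].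

Fact ideal_lmul_subproof (a : R) (x : ideal_sub) : rmul a (val x) \in ideal_pred J.
Proof. by apply/ideal_predP/idealMl/ideal_predP/valP. Qed.
Fact ideal_rmul_subproof (x : ideal_sub) (a : R) : rmul (val x) a \in ideal_pred J.
Proof. by apply/ideal_predP/idealMr/ideal_predP/valP. Qed.

(* The left and right actions of [R] on [J]. *)
Definition ideal_lmul (a : R) (x : ideal_sub) : ideal_sub :=
  Sub (rmul a (val x)) (ideal_lmul_subproof a x).
Definition ideal_rmul (x : ideal_sub) (a : R) : ideal_sub :=
  Sub (rmul (val x) a) (ideal_rmul_subproof x a).

Definition sub_mul (x y : ideal_sub) : ideal_sub := ideal_lmul (val x) y.

Fact sub_mulA : associative sub_mul.
Proof. by move=> x y z; apply: val_inj => /=; apply: rmulA. Qed.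
Fact sub_mulDl : left_distributive sub_mul +%R.
Proof. by move=> x y z; apply: val_inj => /=; apply: rmulDl. Qed.
Fact sub_mulDr : right_distributive sub_mul +%R.
Proof. by move=> x y z; apply: val_inj => /=; apply: rmulDr. Qed.

Definition sub_rng : rng := Rng sub_mulA sub_mulDl sub_mulDr.
End SubRng.

Section Quotient.
Variables (R : rng) (J : ideal R).
Local Notation Q := (Quotient.quot (ideal_pred J)).

Definition quo_mul (x y : Q) : Q := \pi_Q (rmul (repr x) (repr y)).

Lemma quo_eqP (x y : R) : \pi_Q x = \pi_Q y <-> J (x - y).
Proof.
split.
  by move/eqP; rewrite -Quotient.idealrBE => /ideal_predP.
by move=> Jxy; apply/eqP; rewrite -Quotient.idealrBE; apply/ideal_predP.
Qed.

Lemma rmulBl (a x y : R) : rmul (x - y) a = rmul x a - rmul y a.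
Proof.
by apply: (addIr (rmul y a)); rewrite -rmulDl !subrK.
Qed.
Lemma rmulBr (a x y : R) : rmul a (x - y) = rmul a x - rmul a y.
Proof.
by apply: (addIr (rmul a y)); rewrite -rmulDr !subrK.
Qed.

Lemma repr_piJ (x : R) : J (repr (\pi_Q x) - x).
Proof. by apply/quo_eqP; rewrite reprK. Qed.

Lemma idealD (x y : R) : J x -> J y -> J (x + y).
Proof.
move=> Jx Jy; rewrite -[y]opprK -[- y]sub0r; by apply: idealB => //; apply: idealB => //; apply: ideal0.
Qed.

Lemma quo_pi_mul (x y : R) : \pi_Q (rmul x y) = quo_mul (\pi_Q x) (\pi_Q y).
Proof.
apply/esym/quo_eqP; set x' := repr _; set y' := repr _.
have -> : rmul x' y' - rmul x y = rmul x' (y' - y) + rmul (x' - x) y.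
  by rewrite rmulBl rmulBr addrA subrK.
by apply: idealD; [apply: idealMl | apply: idealMr]; apply: repr_piJ.
Qed.

Lemma pi_onto (x : Q) : exists y, x = \pi_Q y.
Proof. by exists (repr x); rewrite reprK. Qed.

Lemma quo_piD (x y : R) : \pi_Q (x + y) = \pi_Q x + \pi_Q y.
Proof. exact: raddfD. Qed.

Fact quo_mulA : associative quo_mul.
Proof.
move=> x y z.
have [a ->] := pi_onto x; have [b ->] := pi_onto y; have [c ->] := pi_onto z.
by rewrite -!quo_pi_mul rmulA.
Qed.
Fact quo_mulDl : left_distributive quo_mul +%R.
Proof.
move=> x y z.
have [a ->] := pi_onto x; have [b ->] := pi_onto y; have [c ->] := pi_onto z.
by rewrite -quo_piD -!quo_pi_mul rmulDl -quo_piD.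
Qed.
Fact quo_mulDr : right_distributive quo_mul +%R.
Proof.
move=> x y z.
have [a ->] := pi_onto x; have [b ->] := pi_onto y; have [c ->] := pi_onto z.
by rewrite -quo_piD -!quo_pi_mul rmulDr -quo_piD.
Qed.

Definition quo_rng : rng := @Rng Q quo_mul quo_mulA quo_mulDl quo_mulDr.

Definition quo_pi : rng_hom R quo_rng :=
  @RngHom R quo_rng (\pi_Q : {additive R -> Q}) quo_pi_mul.

Lemma quo_pi_surj (y : quo_rng) : exists x, quo_pi x = y.
Proof. by exists (repr y); apply: reprK. Qed.
End Quotient.

Section Image.
Variables (R S : rng) (f : rng_hom R S) (J : ideal R).
Hypothesis f_surj : forall y, exists x, f x = y.

Fact image_ideal0 : (f @` J) 0.
Proof. by exists 0; [apply: ideal0 | apply: raddf0]. Qed.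
Fact image_idealB x y : (f @` J) x -> (f @` J) y -> (f @` J) (x - y).
Proof.
move=> [a Ja <-] [b Jb <-]; exists (a - b); first exact: idealB.
exact: raddfB.
Qed.
Fact image_idealMl a x : (f @` J) x -> (f @` J) (rmul a x).
Proof.
move=> [b Jb <-]; have [c <-] := f_surj a.
by exists (rmul c b); [apply: idealMl | apply: homM].
Qed.
Fact image_idealMr a x : (f @` J) x -> (f @` J) (rmul x a).
Proof.
move=> [b Jb <-]; have [c <-] := f_surj a.
by exists (rmul b c); [apply: idealMr | apply: homM].
Qed.

Definition image_ideal : ideal S :=
  Ideal image_ideal0 image_idealB image_idealMl image_idealMr.
End Image.

(* [J / I], as an ideal of [R / I] and as a ring; meant for [I `<=` J]. *)
Definition quo_ideal (R : rng) (I J : ideal R) : ideal (quo_rng I) :=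
  image_ideal J (@quo_pi_surj R I).
Definition subquo (R : rng) (I J : ideal R) : rng := sub_rng (quo_ideal I J).

Section InducedQuo.
Variables (R S : rng) (f : rng_hom R S) (I : ideal R) (I' : ideal S).
Hypothesis fI : I `<=` f @^-1` I'.

Definition quo_map (x : quo_rng I) : quo_rng I' := quo_pi I' (f (repr x)).

Lemma quo_mapE (x : R) : quo_map (quo_pi I x) = quo_pi I' (f x).
Proof.
apply/quo_eqP; rewrite -raddfB; apply: fI; exact: repr_piJ.
Qed.

Fact quo_map_zmod : zmod_morphism quo_map.
Proof.
move=> x y; have [a <-] := quo_pi_surj x; have [b <-] := quo_pi_surj y.
by rewrite -raddfB !quo_mapE !raddfB.
Qed.
HB.instance Definition _ :=
  GRing.isZmodMorphism.Build (quo_rng I) (quo_rng I') quo_map quo_map_zmod.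

Fact quo_mapM x y : quo_map (rmul x y) = rmul (quo_map x) (quo_map y).
Proof.
have [a <-] := quo_pi_surj x; have [b <-] := quo_pi_surj y.
by rewrite -homM !quo_mapE !homM.
Qed.

Definition quo_hom : rng_hom (quo_rng I) (quo_rng I') :=
  @RngHom _ _ (quo_map : {additive _ -> _}) quo_mapM.
End InducedQuo.

Section InducedSub.
Variables (R S : rng) (f : rng_hom R S) (J : ideal R) (J' : ideal S).
Hypothesis fJ : J `<=` f @^-1` J'.

Fact sub_map_subproof (x : sub_rng J) : f (val x) \in ideal_pred J'.
Proof. by apply/ideal_predP/fJ/ideal_predP/valP. Qed.

Definition sub_map (x : sub_rng J) : sub_rng J' := Sub (f (val x)) (sub_map_subproof x).

Fact sub_map_zmod : zmod_morphism sub_map.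
Proof. by move=> x y; apply: val_inj => /=; apply: raddfB. Qed.
HB.instance Definition _ :=
  GRing.isZmodMorphism.Build (sub_rng J) (sub_rng J') sub_map sub_map_zmod.

Fact sub_mapM x y : sub_map (rmul x y) = rmul (sub_map x) (sub_map y).
Proof. by apply: val_inj => /=; apply: homM. Qed.

Definition sub_hom : rng_hom (sub_rng J) (sub_rng J') :=
  @RngHom _ _ (sub_map : {additive _ -> _}) sub_mapM.
End InducedSub.

Section InducedSubquo.
Variables (R S : rng) (f : rng_hom R S).
Variables (I J : ideal R) (I' J' : ideal S).
Hypotheses (fI : I `<=` f @^-1` I') (fJ : J `<=` f @^-1` J').

Fact subquo_hom_subproof : quo_ideal I J `<=` quo_hom fI @^-1` quo_ideal I' J'.
Proof.
move=> _ [x Jx <-]; exists (f x); first exact: fJ.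
by apply/esym; apply: quo_mapE.
Qed.

Definition subquo_hom : rng_hom (subquo I J) (subquo I' J') :=
  sub_hom subquo_hom_subproof.
End InducedSubquo.

(** * Primitive spectra *)

Record rmodule (R : rng) := RModule {
  mod_sort :> zmodType;
  act : R -> mod_sort -> mod_sort;
  actA : forall a b v, act (rmul a b) v = act a (act b v);
  actDl : forall a b v, act (a + b) v = act a v + act b v;
  actDr : forall a v w, act a (v + w) = act a v + act a w }.

Definition simple_module (R : rng) (V : rmodule R) :=
  (exists (a : R) (v : V), act a v <> 0) /\
  (forall v : V, v <> 0 -> forall w, exists a, act a v = w).

Definition annihilator (R : rng) (V : rmodule R) : set R :=
  [set a | forall v : V, act a v = 0].

Definition primitive (R : rng) (P : set R) :=
  exists2 V : rmodule R, simple_module V & P = annihilator V.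

Definition Prim (R : rng) := {P : set R | primitive P}.

(* [F P] is the unique primitive ideal of [R] containing the preimage of [P]. *)
Definition spectrum_preserving (R S : rng) (f : rng_hom R S) :=
  exists2 F : Prim S -> Prim R,
    forall (P : Prim S) (Q : Prim R), f @^-1` sval P `<=` sval Q <-> Q = F P
  & bijective F.

(* The filtrations are indexed by all of [nat], but only their values at
   [0, .., n] matter: beyond [n] they may be taken constant. *)
Definition weakly_spectrum_preserving (R S : rng) (f : rng_hom R S) :=
  exists (n : nat) (J : nat -> ideal R) (I : nat -> ideal S)
         (fJ : forall m, J m `<=` f @^-1` I m),
  [/\ [/\ J 0%N = [set 0] :> set R, J n = [set: R] :> set R
        & forall m, (m < n)%N -> J m `<=` J m.+1],
      [/\ I 0%N = [set 0] :> set S, I n = [set: S] :> set S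
        & forall m, (m < n)%N -> I m `<=` I m.+1]
    & forall m, (m < n)%N -> spectrum_preserving (subquo_hom (fJ m) (fJ m.+1))].

(** * Commutative algebra *)

Definition noetherian (k : comPzRingType) :=
  forall I : ideal (ring_rng k), exists s : seq k,
    I = [set x | exists c : 'I_(size s) -> k, x = \sum_j c j * s`_j] :> set k.

Definition affine_algebra (k : comNzRingType) (B : comAlgType k) :=
  exists s : seq B, forall S : {pred B},
    GRing.subalg_closed S -> {subset s <= S} -> forall b, b \in S.

Definition zero_divisor (B : comPzRingType) (x : B) := exists2 y, y != 0 & x * y = 0.

(** * Algebras with involution *)

Section Involution.
Variable k : comNzRingType.

Record involution (A : algType k) := Involution {
  inv_fun :> {linear A -> A};
  invM : forall a b, inv_fun (a * b) = inv_fun b * inv_fun a;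
  invK : involutive inv_fun }.

Record proper_ideal (A : algType k) := ProperIdeal {
  pideal :> ideal (ring_rng A);
  pideal1 : ~ pideal 1 }.

Section AlgQuotient.
Variables (A : algType k) (J : proper_ideal A).

Definition alg_quo : Type := (Quotient.quot (ideal_pred J)).
HB.instance Definition _ := GRing.Zmodule.on alg_quo.

Local Notation p := (\pi_(Quotient.quot (ideal_pred J)) : A -> alg_quo).

Definition alg_quo_mul : alg_quo -> alg_quo -> alg_quo := @quo_mul _ J.
Definition alg_quo_scale (c : k) (x : alg_quo) : alg_quo := p (c *: repr x).

Let pM (x y : A) : p (x * y) = alg_quo_mul (p x) (p y).
Proof. exact: quo_pi_mul. Qed.
Let pD (x y : A) : p (x + y) = p x + p y.
Proof. exact: quo_piD. Qed.
Let pK (x : alg_quo) : exists y, x = p y.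
Proof. by exists (repr x); rewrite reprK. Qed.

Let pZ c (x : A) : p (c *: x) = alg_quo_scale c (p x).
Proof.
apply/esym/quo_eqP; rewrite -scalerBr -mulr_algl.
by apply: (@idealMl _ J (c%:A)); apply: repr_piJ.
Qed.

Fact alg_quo_mul1l : left_id (p 1) alg_quo_mul.
Proof. by move=> x; have [y ->] := pK x; rewrite -pM mul1r. Qed.
Fact alg_quo_mul1r : right_id (p 1) alg_quo_mul.
Proof. by move=> x; have [y ->] := pK x; rewrite -pM mulr1. Qed.
Fact alg_quo1_neq0 : p 1 != 0.
Proof.
apply/eqP => p1; apply: (@pideal1 _ J).
by rewrite -[1](subr0 (1 : A)); apply/quo_eqP; rewrite p1 raddf0.
Qed.

HB.instance Definition _ := GRing.Zmodule_isNzRing.Build alg_quo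
  (@quo_mulA _ J) alg_quo_mul1l alg_quo_mul1r
  (@quo_mulDl _ J) (@quo_mulDr _ J) alg_quo1_neq0.

Fact alg_quo_scaleA a b v :
  alg_quo_scale a (alg_quo_scale b v) = alg_quo_scale (a * b) v.
Proof. by have [y ->] := pK v; rewrite -!pZ scalerA. Qed.
Fact alg_quo_scale1 : left_id 1 alg_quo_scale.
Proof. by move=> v; have [y ->] := pK v; rewrite -!pZ scale1r. Qed.
Fact alg_quo_scaleDr : right_distributive alg_quo_scale +%R.
Proof.
move=> a u v; have [x ->] := pK u; have [y ->] := pK v.
by rewrite -pD -!pZ scalerDr pD.
Qed.
Fact alg_quo_scaleDl v : {morph alg_quo_scale^~ v : a b / a + b}.
Proof. by move=> a b; have [y ->] := pK v; rewrite -!pZ scalerDl pD. Qed.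

HB.instance Definition _ := GRing.Zmodule_isLmodule.Build k alg_quo
  alg_quo_scaleA alg_quo_scale1 alg_quo_scaleDr alg_quo_scaleDl.

Fact alg_quo_scaleAl a (u v : alg_quo) : a *: (u * v) = (a *: u) * v.
Proof.
have [x ->] := pK u; have [y ->] := pK v.
by rewrite -[LHS]/(alg_quo_scale a (alg_quo_mul (p x) (p y)))
  -[RHS]/(alg_quo_mul (alg_quo_scale a (p x)) (p y)) -pM -!pZ -pM scalerAl.
Qed.
HB.instance Definition _ :=
  GRing.Lmodule_isLalgebra.Build k alg_quo alg_quo_scaleAl.

Fact alg_quo_scaleAr a (u v : alg_quo) : a *: (u * v) = u * (a *: v).
Proof.
have [x ->] := pK u; have [y ->] := pK v.
by rewrite -[LHS]/(alg_quo_scale a (alg_quo_mul (p x) (p y)))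
  -[RHS]/(alg_quo_mul (p x) (alg_quo_scale a (p y))) -pM -!pZ -pM scalerAr.
Qed.
HB.instance Definition _ :=
  GRing.Lalgebra_isAlgebra.Build k alg_quo alg_quo_scaleAr.

Definition alg_pi_fun (x : A) : alg_quo := p x.

Fact alg_pi_zmod : zmod_morphism alg_pi_fun.
Proof. by move=> x y; rewrite /alg_pi_fun raddfB. Qed.
HB.instance Definition _ := GRing.isZmodMorphism.Build A alg_quo alg_pi_fun alg_pi_zmod.

Definition alg_pi : rng_hom (ring_rng A) (ring_rng alg_quo) :=
  @RngHom (ring_rng A) (ring_rng alg_quo) (alg_pi_fun : {additive A -> alg_quo}) pM.

Lemma alg_pi_surj (y : ring_rng alg_quo) : exists x, alg_pi x = y.
Proof. by have [x ->] := pK y; exists x. Qed.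

Lemma alg_pi_eqP (x y : A) : alg_pi x = alg_pi y <-> J (x - y).
Proof. exact: quo_eqP. Qed.

Lemma alg_piZ c (x : A) : alg_pi (c *: x) = c *: alg_pi_fun x.
Proof. exact: pZ. Qed.

Section InducedInvolution.
Variable i : involution A.
Hypothesis iJ : i @` J = J.

Definition quo_inv_fun (x : alg_quo) : alg_quo := alg_pi (i (repr x)).

Lemma quo_inv_funE (x : A) : quo_inv_fun (alg_pi x) = alg_pi (i x).
Proof.
apply/alg_pi_eqP; rewrite -raddfB -iJ.
by eexists; [apply: (@repr_piJ _ J x) |].
Qed.

Fact quo_inv_linear : linear quo_inv_fun.
Proof.
move=> c u v; have [x <-] := alg_pi_surj u; have [y <-] := alg_pi_surj v.
have -> : c *: alg_pi x + alg_pi y = alg_pi (c *: x + y).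
  by rewrite raddfD; congr (_ + _); apply/esym/alg_piZ.
rewrite !quo_inv_funE linearP raddfD; congr (_ + _); exact: alg_piZ.
Qed.
HB.instance Definition _ :=
  GRing.isLinear.Build k alg_quo alg_quo *:%R quo_inv_fun quo_inv_linear.

Fact quo_invM u v : quo_inv_fun (u * v) = quo_inv_fun v * quo_inv_fun u.
Proof.
have [x <-] := alg_pi_surj u; have [y <-] := alg_pi_surj v.
have pME a b : (alg_pi a : alg_quo) * alg_pi b = alg_pi (a * b) by apply/esym/pM.
by rewrite pME !quo_inv_funE invM pME.
Qed.

Fact quo_invK : involutive quo_inv_fun.
Proof. by move=> u; have [x <-] := alg_pi_surj u; rewrite !quo_inv_funE invK. Qed.

Definition quo_inv : involution alg_quo :=
  @Involution _ (quo_inv_fun : {linear _ -> _}) quo_invM quo_invK.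
End InducedInvolution.
End AlgQuotient.

Section RestrictInvolution.
Variables (A : algType k) (i : involution A) (J : ideal (ring_rng A)).
Hypothesis iJ : i @` J = J.

Fact ideal_inv_subproof (x : ideal_sub J) : i (val x) \in ideal_pred J.
Proof.
by apply/ideal_predP; rewrite -iJ; exists (val x) => //; apply/ideal_predP/valP.
Qed.
Definition ideal_inv (x : ideal_sub J) : ideal_sub J :=
  Sub (i (val x)) (ideal_inv_subproof x).
End RestrictInvolution.

(** * Affine cell ideals *)

(* The basis [v_1, .., v_d] of [V] is fixed once and for all, so that [V (x) B],
   [B (x) V] and [V (x) B (x) V] become the columns, the rows and the square
   matrices of size [d] over [B], with [v_r (x) b (x) v_s] the matrix [b E_rs].
   As [B] is commutative, its right action on columns is scaling. *)
Record cell_module (A : algType k) (B : comAlgType k) (d : nat) := CellModule {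
  cm_act :> A -> {linear 'cV[B]_d -> 'cV[B]_d};
  cm_act1 : forall v, cm_act 1 v = v;
  cm_actM : forall a b v, cm_act (a * b) v = cm_act a (cm_act b v);
  cm_actD : forall a b v, cm_act (a + b) v = cm_act a v + cm_act b v;
  cm_actZ : forall (c : k) a v, cm_act (c *: a) v = (c%:A : B) *: cm_act a v }.

(* The right action on [B (x) V]; the transpose plays the role of the flip. *)
Definition dual_act (A : algType k) (i : involution A) (B : comAlgType k)
    (d : nat) (D : cell_module A B d) (w : 'rV[B]_d) (a : A) : 'rV[B]_d :=
  (D (i a) w^T)^T.

(* An affine cell ideal together with its cell datum. Since [Delta (x)_B Delta']
   is the space of matrices, its left (resp. right) [A]-action is the action of
   [Delta] on columns (resp. of [Delta'] on rows). [cd_psi] is the swich matrix. *)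
Record cell_datum (A : algType k) (i : involution A) (J : ideal (ring_rng A)) :=
  CellDatum {
  cd_iJ : i @` J = J;
  cd_rank : nat;
  cd_rank_gt0 : (0 < cd_rank)%N;
  cd_B : comAlgType k;
  cd_affine : affine_algebra cd_B;
  cd_sigma : involution cd_B;
  cd_Delta : cell_module A cd_B cd_rank;
  cd_alpha : {additive ideal_sub J -> 'M[cd_B]_cd_rank};
  cd_alphaV : 'M[cd_B]_cd_rank -> ideal_sub J;
  cd_alphaK : cancel cd_alpha cd_alphaV;
  cd_alphaVK : cancel cd_alphaV cd_alpha;
  cd_alpha_lmul : forall (a : A) x s,
    col s (cd_alpha (ideal_lmul (J := J) a x)) = cd_Delta a (col s (cd_alpha x));
  cd_alpha_rmul : forall (a : A) x r,
    row r (cd_alpha (ideal_rmul (J := J) x a)) = dual_act i cd_Delta (row r (cd_alpha x)) a;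
  cd_alpha_inv : forall X,
    cd_alpha (ideal_inv cd_iJ (cd_alphaV X)) = (map_mx cd_sigma X)^T;
  cd_psi : 'M[cd_B]_cd_rank;
  cd_alphaM : forall x y,
    cd_alpha (sub_mul x y) = cd_alpha x *m cd_psi *m cd_alpha y }.

(** * Affine cellular algebras *)

(* Summands are numbered from 0; [chain m] is the sum of the first [m] ones. The
   inclusions are strict since the layers, in bijection with matrices, are nonzero. *)
Record cell_chain (A : algType k) (i : involution A) := CellChain {
  chain_len : nat;
  chain_comp : 'I_chain_len -> set A;
  chain_comp0 : forall j, chain_comp j 0;
  chain_compP : forall j (c : k) x y,
    chain_comp j x -> chain_comp j y -> chain_comp j (c *: x + y);
  chain_comp_inv : forall j, i @` chain_comp j = chain_comp j;
  chain_direct : forall a : A, exists! x : {ffun 'I_chain_len -> A},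
    (forall j, chain_comp j (x j)) /\ a = \sum_j x j;
  chain : nat -> ideal (ring_rng A);
  chainE : forall m, chain m =
    [set a | exists2 x : {ffun 'I_chain_len -> A},
       forall j, chain_comp j (x j)
     & a = \sum_(j < chain_len | (j < m)%N) x j] :> set A;
  chain_strict : forall j : 'I_chain_len, chain j `<` chain j.+1 }.

Section Chain.
Variables (A : algType k) (i : involution A) (C : cell_chain i).
Local Notation n := (chain_len C).

Lemma chain_proper (j : 'I_n) : ~ chain C j 1.
Proof.
move=> C1; have [_] := chain_strict j; apply=> x _.
by rewrite -[x]mulr1; apply: (@idealMl _ (chain C j)).
Qed.

Lemma chain_inv m : i @` chain C m = chain C m.
Proof.
have sub a : chain C m a -> chain C m (i a).
  rewrite !chainE => -[x Cx ->]; exists [ffun j => i (x j)].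
    by move=> j; rewrite ffunE -chain_comp_inv; exists (x j).
  by rewrite raddf_sum; apply: eq_bigr => j _; rewrite ffunE.
apply/seteqP; split=> [_ [a Ca <-]|a Ca]; first exact: sub.
by exists (i a); [apply: sub | apply: invK].
Qed.

Definition chain_pideal (j : 'I_n) : proper_ideal A := ProperIdeal (@chain_proper j).

Definition chain_quo (j : 'I_n) : algType k := alg_quo (chain_pideal j).

Definition chain_quo_inv (j : 'I_n) : involution (chain_quo j) :=
  quo_inv (J := chain_pideal j) (chain_inv j).

(* The ideal [chain j.+1 / chain j] of [A / chain j]. *)
Definition layer (j : 'I_n) : ideal (ring_rng (chain_quo j)) :=
  image_ideal (chain C j.+1) (@alg_pi_surj A (chain_pideal j)).
End Chain.

Record affine_cellular (A : algType k) (i : involution A) := AffineCellular {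
  cell_chain_of :> cell_chain i;
  cell_data : forall j : 'I_(chain_len cell_chain_of),
    cell_datum (chain_quo_inv j) (layer j) }.
End Involution.

Arguments cd_alphaV {k A i J} c X.

(** * The asymptotic algebra *)

Section ProdRing.
Variables (I : Type) (R : I -> pzRingType).

Definition prod_ring : Type := forall j, R j.
HB.instance Definition _ := Choice.on prod_ring.

Let zero : prod_ring := fun=> 0.
Let opp (x : prod_ring) : prod_ring := fun j => - x j.
Let add (x y : prod_ring) : prod_ring := fun j => x j + y j.
Let one : prod_ring := fun=> 1.
Let mul (x y : prod_ring) : prod_ring := fun j => x j * y j.

Let addA : associative add.
Proof. by move=> x y z; apply: functional_extensionality_dep => j; apply: addrA. Qed.
Let addC : commutative add.
Proof. by move=> x y; apply: functional_extensionality_dep => j; apply: addrC. Qed.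
Let add0 : left_id zero add.
Proof. by move=> x; apply: functional_extensionality_dep => j; apply: add0r. Qed.
Let addN : left_inverse zero opp add.
Proof. by move=> x; apply: functional_extensionality_dep => j; apply: addNr. Qed.
Let mulA : associative mul.
Proof. by move=> x y z; apply: functional_extensionality_dep => j; apply: mulrA. Qed.
Let mul1 : left_id one mul.
Proof. by move=> x; apply: functional_extensionality_dep => j; apply: mul1r. Qed.
Let mulx1 : right_id one mul.
Proof. by move=> x; apply: functional_extensionality_dep => j; apply: mulr1. Qed.
Let mulDl : left_distributive mul add.
Proof. by move=> x y z; apply: functional_extensionality_dep => j; apply: mulrDl. Qed.
Let mulDr : right_distributive mul add.
Proof. by move=> x y z; apply: functional_extensionality_dep => j; apply: mulrDr. Qed.

HB.instance Definition _ := GRing.isPzRing.Build prod_ring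
  addA addC add0 addN mulA mul1 mulx1 mulDl mulDr.
End ProdRing.

Section Asymptotic.
Variables (k : comNzRingType) (A : algType k) (i : involution A).
Variable C : affine_cellular i.
Local Notation n := (chain_len C).

Definition cell_psi (j : 'I_n) := cd_psi (cell_data j).

Definition asym : pzRingType :=
  prod_ring (fun j : 'I_n => 'M[cd_B (cell_data j)]_(cd_rank (cell_data j))).

Definition cell_e (j : 'I_n) : ideal_sub (layer j) :=
  cd_alphaV (cell_data j) 1%:M.

Definition theta_fun (a : A) : asym := fun j =>
  cd_alpha (cell_data j) (ideal_lmul (alg_pi (chain_pideal j) a) (cell_e j)).

Lemma col_theta j a s :
  col s (theta_fun a j) =
  cd_Delta (cell_data j) (alg_pi (chain_pideal j) a) (col s 1%:M).
Proof. by rewrite cd_alpha_lmul /cell_e cd_alphaVK. Qed.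

Lemma theta_act j a v :
  cd_Delta (cell_data j) (alg_pi (chain_pideal j) a) v = theta_fun a j *m v.
Proof.
set T := theta_fun a j.
have -> : v = \sum_s v s 0 *: col s 1%:M.
  apply/colP => r; rewrite summxE (bigD1 r) //= !mxE eqxx mulr1 big1 ?addr0 //.
  by move=> s sr; rewrite !mxE eq_sym (negPf sr) mulr0.
rewrite linear_sum mulmx_sumr; apply: eq_bigr => s _.
by rewrite linearZ -scalemxAr /= -col_theta !colE mul1mx.
Qed.

Fact theta_zmod : zmod_morphism theta_fun.
Proof.
move=> a b; apply: functional_extensionality_dep => j.
rewrite -[RHS]/(theta_fun a j - theta_fun b j) /theta_fun -raddfB; congr (cd_alpha _ _).
apply: val_inj => /=; rewrite raddfB; exact: mulrBl.
Qed.
HB.instance Definition _ := GRing.isZmodMorphism.Build A asym theta_fun theta_zmod.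

Fact thetaM a b : theta_fun (a * b) = theta_fun a * theta_fun b.
Proof.
apply: functional_extensionality_dep => j.
rewrite -[RHS]/(theta_fun a j *m theta_fun b j).
apply/matrixP => r s; have := col_theta (a * b) s.
rewrite (homM (alg_pi (chain_pideal j)) a b) cm_actM -col_theta theta_act.
rewrite !colE mulmxA -!colE.
by move/colP/(_ r); rewrite !mxE.
Qed.

Definition theta : rng_hom (ring_rng A) (ring_rng asym) :=
  @RngHom (ring_rng A) (ring_rng asym) (theta_fun : {additive A -> asym}) thetaM.
End Asymptotic.

(* Main.v *)
Require Import Defs.
From HB Require Import structures.
From mathcomp Require Import all_boot all_algebra.
From mathcomp Require Import boolp classical_sets.
Set Implicit Arguments.
Unset Strict Implicit.
Unset Printing Implicit Defensive.
Import GRing.Theory.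
Local Open Scope ring_scope.
Local Open Scope quotient_scope.
Local Open Scope classical_set_scope.

(** Through [alpha_j], the layer [J_j / J_(j-1)] is the ring of matrices with the
    twisted product [x * psi * y], and [Theta] becomes [x |-> x * psi] on it.
    The layer is idempotent iff [1] is in the ideal generated by [psi]. In this
    case [P |-> {x | psi * x * psi \in P}] is a bijection between the spectra of the
    two products, and it is the only one compatible with [x |-> x * psi] since
    primitive ideals of matrices over a commutative ring are maximal. Otherwise
    some primitive ideal [P] contains [psi], and its preimage in [A] contains the
    whole of [J_j].  When arbitrary filtrations make [Theta] weakly spectrum
    preserving, they still provide a bijection between [Prim A^] and [Prim A]; a
    descending induction on [j] shows that it matches the primitive ideals of
    the [j]-th factor with those of [A] which contain [J_(j-1)] but not [J_j],
    and this excludes such a [P]. *)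

(** * Simple modules as quotients by left ideals *)

Lemma rmul0l (T : rng) (x : T) : rmul 0 x = 0.
Proof. by apply: (addrI (rmul 0 x)); rewrite -rmulDl !addr0. Qed.

Record left_ideal (T : rng) (L : set T) : Prop := LeftIdeal {
  left_ideal0 : L 0;
  left_idealB : forall x y, L x -> L y -> L (x - y);
  left_idealM : forall a x, L x -> L (rmul a x) }.

Section LeftIdealTheory.
Variables (T : rng) (L : set T).
Hypothesis HL : left_ideal L.

Lemma left_idealN x : L x -> L (- x).
Proof. by move=> Lx; rewrite -sub0r; apply: (left_idealB HL) => //; apply: left_ideal0. Qed.

Lemma left_idealD x y : L x -> L y -> L (x + y).
Proof. by move=> Lx Ly; rewrite -[y]opprK; apply: (left_idealB HL) => //; apply: left_idealN. Qed.

Lemma left_idealBr x y : L (x - y) -> L x -> L y.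
Proof. by move=> Lxy Lx; rewrite -[y](subKr x); apply: (left_idealB HL). Qed.

Lemma left_ideal_sum (I : Type) (r : seq I) (F : I -> T) :
  (forall i, L (F i)) -> L (\sum_(i <- r) F i).
Proof.
by move=> LF; elim/big_ind: _ => //; [apply: left_ideal0 | apply: left_idealD].
Qed.

End LeftIdealTheory.

(* The module [T / L] is then simple. *)
Record irreducible (T : rng) (L : set T) : Prop := Irreducible {
  irr_left : left_ideal L;
  irr_proper : exists x, ~ L x;
  irr_max : forall x, ~ L x -> forall z, exists a, L (rmul a x - z) }.

(** The annihilator of the module [T / L]. *)
Definition core (T : rng) (L : set T) : set T := [set a | forall x, L (rmul a x)].

Section Cyclic.
Variables (T : rng) (L : set T).
Hypothesis HL : irreducible L.
Let HL0 := irr_left HL.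

Definition left_pred : {pred T} := fun x => `[< L x >].
Fact left_pred_zmod_closed : zmod_closed left_pred.
Proof.
split=> [|x y /asboolP Lx /asboolP Ly]; apply/asboolP; first exact: left_ideal0.
exact: (left_idealB HL0).
Qed.
HB.instance Definition _ := GRing.isZmodClosed.Build T left_pred left_pred_zmod_closed.

Local Notation Q := (Quotient.quot left_pred).

Let piP (x y : T) : \pi_Q x = \pi_Q y <-> L (x - y).
Proof.
split; first by move/eqP; rewrite -Quotient.idealrBE => /asboolP.
by move=> Lxy; apply/eqP; rewrite -Quotient.idealrBE; apply/asboolP.
Qed.

Let cyclic_act (a : T) (v : Q) : Q := \pi_Q (rmul a (repr v)).

Let cyclic_actE a x : cyclic_act a (\pi_Q x) = \pi_Q (rmul a x).
Proof.
apply/piP; rewrite -rmulBr; apply: (left_idealM HL0).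
by apply/piP; rewrite reprK.
Qed.

Let pi_surj (v : Q) : exists x, v = \pi_Q x.
Proof. by exists (repr v); rewrite reprK. Qed.
Let piD (x y : T) : \pi_Q (x + y) = \pi_Q x + \pi_Q y.
Proof. exact: raddfD. Qed.

Let cyclic_actA a b v : cyclic_act (rmul a b) v = cyclic_act a (cyclic_act b v).
Proof. by have [x ->] := pi_surj v; rewrite !cyclic_actE rmulA. Qed.
Let cyclic_actDl a b v : cyclic_act (a + b) v = cyclic_act a v + cyclic_act b v.
Proof. by have [x ->] := pi_surj v; rewrite !cyclic_actE rmulDl piD. Qed.
Let cyclic_actDr a v w : cyclic_act a (v + w) = cyclic_act a v + cyclic_act a w.
Proof.
have [x ->] := pi_surj v; have [y ->] := pi_surj w.
by rewrite -piD !cyclic_actE rmulDr piD.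
Qed.

Let cyclic_module := RModule cyclic_actA cyclic_actDl cyclic_actDr.

Let pi0 x : \pi_Q x = 0 <-> L x.
Proof. by have := piP x 0; rewrite subr0 raddf0. Qed.

(** Since [T] may lack a unit, it must be checked that [T] does not kill [T / L]: [irr_max] with
    [z := x] yields an [a] fixing the nonzero class of [x]. *)
Lemma core_primitive : primitive (core L).
Proof.
exists cyclic_module.
  split=> [|v].
    have [x Lx] := irr_proper HL; have [a La] := irr_max HL Lx x.
    exists a, (\pi_Q x); rewrite /= cyclic_actE => /pi0 Lax; apply: Lx.
    exact: (left_idealBr HL0 La).
  have [x ->] := pi_surj v => x0 w; have [z ->] := pi_surj w.
  have Lx : ~ L x by move/pi0.
  by have [a La] := irr_max HL Lx z; exists a; rewrite /= cyclic_actE; apply/piP.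
apply/seteqP; split=> a /= Ha.
  by move=> v; have [x ->] := pi_surj v; rewrite /= cyclic_actE; apply/pi0.
by move=> x; apply/pi0; rewrite -cyclic_actE; apply: Ha.
Qed.
End Cyclic.

Section Primitive.
Variable T : rng.
Implicit Types P : set T.

Lemma act0 (V : rmodule T) a : act a (0 : V) = 0.
Proof. by apply: (addrI (act a 0)); rewrite -actDr !addr0. Qed.

Lemma act0l (V : rmodule T) (v : V) : act 0 v = 0.
Proof. by apply: (addrI (act 0 v)); rewrite -actDl !addr0. Qed.

Lemma actBl (V : rmodule T) a b (v : V) : act (a - b) v = act a v - act b v.
Proof. by apply: (addIr (act b v)); rewrite -actDl !subrK. Qed.

(** A nonzero vector [v0] generates a simple module, which is thus [T / L] for [L] the annihilator
    of [v0]. From here on, left ideals replace modules. *)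
Lemma primitiveP P : primitive P <-> exists2 L, irreducible L & P = core L.
Proof.
split; last by move=> [L HL ->]; apply: core_primitive.
move=> [V [[a [v0 av0]] Vsimple] ->].
have nz : v0 <> 0 by move=> v00; apply: av0; rewrite v00 act0.
exists [set x | act x v0 = 0].
  split; last 2 first.
  - by have [x xv0] := Vsimple _ nz v0; exists x; rewrite /= xv0.
  - move=> x /= Hx z; have [b Hb] := Vsimple _ Hx (act z v0).
    by exists b; rewrite actBl actA Hb subrr.
  split=> /= [|x y Hx Hy|b x Hx]; first exact: act0l.
    by rewrite actBl Hx Hy subrr.
  by rewrite actA Hx act0.
apply/seteqP; split=> b /= Hb; first by move=> x; rewrite /= actA.
by move=> v; have [x <-] := Vsimple _ nz v; rewrite -actA; apply: Hb.
Qed.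

Variables (P : set T) (HP : primitive P).

Lemma primitive0 : P 0.
Proof.
have [L [HL _ _] ->] := (primitiveP P).1 HP => x.
by rewrite rmul0l; apply: left_ideal0.
Qed.

Lemma primitiveB x y : P x -> P y -> P (x - y).
Proof.
have [L [HL _ _] ->] := (primitiveP P).1 HP => Px Py z.
by rewrite rmulBl; apply: (left_idealB HL); [apply: Px | apply: Py].
Qed.

Lemma primitiveMl a x : P x -> P (rmul a x).
Proof.
have [L [HL _ _] ->] := (primitiveP P).1 HP => Px z.
by rewrite -rmulA; apply: (left_idealM HL); apply: Px.
Qed.

Lemma primitiveMr a x : P x -> P (rmul x a).
Proof.
have [L [HL _ _] ->] := (primitiveP P).1 HP => Px z.
by rewrite -rmulA; apply: Px.
Qed.

Lemma primitive_left : left_ideal P.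
Proof.
by split; [apply: primitive0 | apply: primitiveB | apply: primitiveMl].
Qed.

Lemma primitive_neqT : P <> setT.
Proof.
have [L [HL [x Lx] Lmax] ->] := (primitiveP P).1 HP => PT.
have [a La] := Lmax _ Lx x; apply: Lx; apply: (left_idealBr HL La).
by have : core L a by rewrite PT.
Qed.

(** As [J] does not kill [T / L], some [b] in [J] moves some [x] outside of [L]. Every [z] is then
    [c b x] modulo [L], and [c b] is in [J], so [a] kills [z]. *)
Lemma primitive_prime (J : ideal T) a : ~ J `<=` P ->
  (forall b, J b -> P (rmul a b)) -> P a.
Proof.
have [L [HL _ Lmax] ->] := (primitiveP P).1 HP => nJP Pab z.
have [b Jb [x Lx]] : exists2 b, J b & exists x, ~ L (rmul b x).
  apply: contrapT => nex; apply: nJP => b Jb x; apply: contrapT => Lx.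
  by apply: nex; exists b => //; exists x.
have [c Lc] := Lmax _ Lx z.
apply: (left_idealBr HL (x := rmul a (rmul c (rmul b x)))).
  by rewrite -rmulBr; apply: (left_idealM HL).
rewrite rmulA -rmulA [rmul c _]rmulA rmulA; apply: Pab.
exact: idealMl.
Qed.
End Primitive.

(** * Spectra of subquotients *)

Section SpectralBijection.

(** Bijections are handled as relations between subsets rather than as functions between types
    [Prim], so that layers of different filtrations can be compared inside one spectrum. *)
Definition bij_rel (X Y : Type) (A : set X) (B : set Y) (r : X -> Y -> Prop) :=
  (forall x, A x -> exists2 y, B y /\ r x y & forall y', B y' -> r x y' -> y' = y) /\
  (forall y, B y -> exists2 x, A x /\ r x y & forall x', A x' -> r x' y -> x' = x).

Definition pre_sub (R S : Type) (f : R -> S) (P : set S) (Q : set R) :=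
  f @^-1` P `<=` Q.

Lemma spectrum_preservingE (R S : rng) (f : rng_hom R S) :
  spectrum_preserving f <-> bij_rel (@primitive S) (@primitive R) (pre_sub f).
Proof.
split.
  move=> [F HF [G GK FK]]; split=> [P HP|Q HQ].
    exists (sval (F (exist _ P HP))).
      split; first exact: svalP.
      exact: ((HF (exist _ P HP) _).2 erefl).
    move=> Q' HQ' /(HF (exist _ P HP) (exist _ Q' HQ')) e.
    by rewrite -e.
  exists (sval (G (exist _ Q HQ))).
    split; first exact: svalP.
    by apply: ((HF _ (exist _ Q HQ)).2); rewrite FK.
  move=> P' HP' /(HF (exist _ P' HP') (exist _ Q HQ)) ->.
  by rewrite GK.
move=> [H1 H2].
have sig_eq (T : rng) (P Q : Prim T) : sval P = sval Q -> P = Q.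
  by case: P Q => P HP [Q HQ] /= e; case: _ / e HQ => HQ; rewrite (Prop_irrelevance HP HQ).
have [F HF] : {F : Prim S -> Prim R & forall P, pre_sub f (sval P) (sval (F P))
    /\ forall Q', primitive Q' -> pre_sub f (sval P) Q' -> Q' = sval (F P)}.
  apply: (@choice _ _ (fun (P : Prim S) (Q : Prim R) => pre_sub f (sval P) (sval Q)
    /\ forall Q', primitive Q' -> pre_sub f (sval P) Q' -> Q' = sval Q)).
  move=> P; have [Q [HQ PQ] Q1] := H1 _ (svalP P).
  by exists (exist _ Q HQ).
have [G HG] : {G : Prim R -> Prim S & forall Q, pre_sub f (sval (G Q)) (sval Q)
    /\ forall P', primitive P' -> pre_sub f P' (sval Q) -> P' = sval (G Q)}.
  apply: (@choice _ _ (fun (Q : Prim R) (P : Prim S) => pre_sub f (sval P) (sval Q)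
    /\ forall P', primitive P' -> pre_sub f P' (sval Q) -> P' = sval P)).
  move=> Q; have [P [HP PQ] P1] := H2 _ (svalP Q).
  by exists (exist _ P HP).
exists F.
  move=> P Q; split=> [PQ|->]; last exact: (HF P).1.
  by apply: sig_eq; apply: (HF P).2 => //; apply: svalP.
exists G => [P|Q]; apply: sig_eq; apply/esym.
  by apply: (HG _).2; [apply: svalP | apply: (HF _).1].
by apply: (HF _).2; [apply: svalP | apply: (HG _).1].
Qed.

Definition bij_on (X Y : Type) (A : set X) (B : set Y) (u : X -> Y) :=
  [/\ forall x, A x -> B (u x),
      forall y, B y -> exists2 x, A x & u x = y
    & forall x x', A x -> A x' -> u x = u x' -> x = x'].

Lemma bij_rel_transport (X Y X' Y' : Type) (A : set X) (B : set Y) (A' : set X')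
    (B' : set Y') (r : X -> Y -> Prop) (r' : X' -> Y' -> Prop)
    (u : X -> X') (v : Y -> Y') :
  bij_on A A' u -> bij_on B B' v ->
  (forall x y, A x -> B y -> r' (u x) (v y) <-> r x y) ->
  bij_rel A' B' r' <-> bij_rel A B r.
Proof.
move=> [Au surjU injU] [Bv surjV injV] rr'; split=> -[H1 H2]; split.
- move=> x Ax; have [_ [/surjV[y By <-] /rr' rxy] y1] := H1 _ (Au _ Ax).
  exists y; first by split=> //; apply: rxy.
  by move=> y' By' /rr' ry'; apply: injV => //; apply: y1; [apply: Bv | apply: ry'].
- move=> y By; have [_ [/surjU[x Ax <-] /rr' rxy] x1] := H2 _ (Bv _ By).
  exists x; first by split=> //; apply: rxy.
  by move=> x' Ax' /rr' rx'; apply: injU => //; apply: x1; [apply: Au | apply: rx'].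
- move=> _ /surjU[x Ax <-]; have [y [By rxy] y1] := H1 _ Ax.
  exists (v y); first by split; [apply: Bv | apply/rr'].
  by move=> _ /surjV[y' By' <-] /rr' ry'; rewrite (y1 y') //; apply: ry'.
- move=> _ /surjV[y By <-]; have [x [Ax rxy] x1] := H2 _ By.
  exists (u x); first by split; [apply: Au | apply/rr'].
  by move=> _ /surjU[x' Ax' <-] /rr' rx'; rewrite (x1 x') //; apply: rx'.
Qed.
End SpectralBijection.

(* [p] identifies [T] with [J / I]; its values outside of [J] are irrelevant. *)
Record subquotient (R T : rng) (I J : ideal R) (p : R -> T) : Prop := Subquotient {
  subquoB : forall x y, J x -> J y -> p (x - y) = p x - p y;
  subquoM : forall x y, J x -> J y -> p (rmul x y) = rmul (p x) (p y);
  subquo_surj : forall t, exists2 x, J x & p x = t;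
  subquo_ker : forall x, J x -> p x = 0 <-> I x }.

(** The stratum of the spectrum of [R] that corresponds to the spectrum of [J / I], by [trace_bij]
    below. *)
Definition prim_between (R : rng) (I J : ideal R) : set (set R) :=
  [set P | [/\ primitive P, I `<=` P & ~ J `<=` P]].

(** For [a] in [P] the products [a b] with [b] in [J] lie in both [P] and [J], hence in [Q]; [Q]
    being prime, [a] follows. *)
Lemma primitive_sub (R : rng) (J : ideal R) (P Q : set R) :
  primitive P -> primitive Q -> ~ J `<=` Q -> P `&` J `<=` Q -> P `<=` Q.
Proof.
move=> HP HQ nJQ PJQ.
move=> a Pa; apply: (primitive_prime HQ nJQ) => b Jb; apply: PJQ.
by split; [apply: primitiveMr | apply: idealMl].
Qed.

Section SubquotientSpectrum.
Variables (R T : rng) (I J : ideal R) (p : R -> T).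
Hypothesis Hp : subquotient I J p.

Definition trace (Q : set R) : set T := p @` (J `&` Q).

Lemma traceE Q x : prim_between I J Q -> J x -> trace Q (p x) <-> Q x.
Proof.
move=> [HQ IQ _] Jx; split; last by move=> Qx; exists x.
move=> [y [Jy Qy] pxy]; apply: (left_idealBr (primitive_left HQ) _ Qy).
apply: IQ; apply/(subquo_ker Hp); first exact: idealB.
by rewrite (subquoB Hp) // pxy subrr.
Qed.

(** The simple module [R / L] is killed by [I] but not by [J], so it stays simple over [J] and
    becomes a simple [T]-module, with annihilator [trace Q]. *)
Lemma trace_primitive Q : prim_between I J Q -> primitive (trace Q).
Proof.
move=> HQ; have [/primitiveP[L HL defQ] IQ nJQ] := HQ.
have [HL0 [x0 Lx0] Lmax] := HL.
have LJ x : ~ L x -> exists2 b, J b & ~ L (rmul b x).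
  move=> Lx; apply: contrapT => nex; apply: nJQ; rewrite defQ => b Jb z.
  have [a La] := Lmax _ Lx z.
  apply: (left_idealBr HL0 (x := rmul b (rmul a x))).
    by rewrite -rmulBr; apply: (left_idealM HL0).
  apply: contrapT => Lbax; apply: nex; exists (rmul b a); first exact: Defs.idealMr.
  by rewrite -rmulA.
have LJmax x z : ~ L x -> exists2 a, J a & L (rmul a x - z).
  move=> Lx; have [b Jb Lbx] := LJ x Lx; have [a La] := Lmax _ Lbx z.
  by exists (rmul a b); [apply: idealMl | rewrite -rmulA].
(* The annihilator in [T] of the class of [x0]. *)
pose L' : set T := p @` (J `&` [set x | L (rmul x x0)]).
have L'E x : J x -> L' (p x) <-> L (rmul x x0).
  move=> Jx; split; last by move=> Lx; exists x.
  move=> [y [Jy Ly] pxy]; apply: (left_idealBr HL0 _ Ly).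
  have : I (y - x).
    by apply/(subquo_ker Hp); [apply: idealB | rewrite (subquoB Hp) // pxy subrr].
  by move=> /IQ; rewrite defQ => /(_ x0); rewrite rmulBl.
apply/primitiveP; exists L'.
  split.
  - split.
    + exists 0; last exact/(subquo_ker Hp)/ideal0/ideal0.
      by split; [apply: ideal0 | rewrite /= rmul0l; apply: left_ideal0].
    + move=> _ _ [x [Jx /= Lx] <-] [y [Jy /= Ly] <-]; exists (x - y).
        by split; [apply: idealB | rewrite /= rmulBl; apply: (left_idealB HL0)].
      by rewrite (subquoB Hp).
    + move=> t _ [x [Jx /= Lx] <-]; have [a Ja <-] := subquo_surj Hp t.
      exists (rmul a x); last by rewrite (subquoM Hp).
      by split; [apply: idealMl | rewrite /= -rmulA; apply: (left_idealM HL0)].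
  - by have [b Jb Lb] := LJ _ Lx0; exists (p b) => /(L'E _ Jb).
  - move=> t; have [x Jx <-] := subquo_surj Hp t => L'x s.
    have [z Jz <-] := subquo_surj Hp s.
    have Lx : ~ L (rmul x x0) by move=> /(L'E _ Jx).
    have [a Ja La] := LJmax _ (rmul z x0) Lx; exists (p a).
    rewrite -(subquoM Hp) // -(subquoB Hp) //; last exact: idealMl.
    apply/L'E; first by apply: idealB => //; apply: idealMl.
    by rewrite rmulBl -rmulA.
apply/seteqP; split=> t; have [y Jy <-] := subquo_surj Hp t.
  move=> /(traceE HQ Jy) Qy s; have [x Jx <-] := subquo_surj Hp s.
  rewrite -(subquoM Hp) //; apply/L'E; first exact: idealMl.
  by rewrite -rmulA; move: Qy; rewrite defQ; apply.
move=> L'y; apply/(traceE HQ Jy); rewrite defQ => z.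
have [a Ja La] := LJmax _ z Lx0; apply: (left_idealBr HL0 (x := rmul y (rmul a x0))).
  by rewrite -rmulBr; apply: (left_idealM HL0).
have := L'y (p a); rewrite -(subquoM Hp) // => /L'E; rewrite rmulA; apply.
exact: idealMl.
Qed.

(** The simple module [T / L] extends to [R]: an element [a] sends the class of [p x], for [x] in
    [J], to that of [p (a x)]. Below, [L1] is the annihilator in [R] of the class of [t0 = p x0]. *)
Lemma trace_surj Q' : primitive Q' -> exists2 Q, prim_between I J Q & trace Q = Q'.
Proof.
move=> /primitiveP[L [HL0 [t0 Lt0] Lmax] ->].
have [x0 Jx0 px0] := subquo_surj Hp t0.
pose L1 := [set x | L (p (rmul x x0))].
have JM a x : J x -> J (rmul a x) by apply: idealMl.
(* The extended action is well defined: if [p (a x)] were not in [L], some [p b] would fix its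
   class, whereas [p b] times [p (a x)] is [p (b a)] times [p x], which is in [L]. *)
have LM a x : J x -> L (p x) -> L (p (rmul a x)).
  move=> Jx Lx; apply: contrapT => Lax; apply: Lax.
  apply: contrapT => Lax; have [s Ls] := Lmax _ Lax (p (rmul a x)); apply: Lax.
  apply: (left_idealBr HL0 Ls); have [b Jb <-] := subquo_surj Hp s.
  rewrite -(subquoM Hp) //; last exact: JM.
  rewrite rmulA (subquoM Hp) //; last exact: Defs.idealMr.
  exact: (left_idealM HL0).
have L1irr : irreducible L1.
  split.
  - split; rewrite /L1 /=.
    + by rewrite rmul0l (subquo_ker Hp (ideal0 J)).2; [apply: left_ideal0 | apply: ideal0].
    + move=> x y Lx Ly.
      by rewrite rmulBl (subquoB Hp); [apply: (left_idealB HL0) | apply: JM | apply: JM].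
    + by move=> a x Lx; rewrite -rmulA; apply: LM => //; apply: JM.
  - have [s Ls] := Lmax _ Lt0 t0; have [b Jb pb] := subquo_surj Hp s.
    exists b; rewrite /L1 /= (subquoM Hp) // pb px0 => Lst.
    by apply: Lt0; apply: (left_idealBr HL0 Ls).
  - move=> x L1x z; have [s Ls] := Lmax _ L1x (p (rmul z x0)).
    have [b Jb pb] := subquo_surj Hp s; exists b.
    rewrite /L1 /= rmulBl -rmulA; have Jx : J (rmul x x0) by apply: JM.
    by rewrite (subquoB Hp (JM _ _ Jx) (JM _ _ Jx0)) (subquoM Hp Jb Jx) pb.
(* Each [p x] is congruent to some [p (b x0)] modulo [L], so killing the multiples of [x0] amounts
   to killing the whole module. *)
have L1E a : core L1 a <-> forall x, J x -> L (p (rmul a x)).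
  split=> [L1a x Jx|La x]; last by rewrite /L1 /= -rmulA; apply/La/JM.
  have [s Ls] := Lmax _ Lt0 (p x); have [b Jb pb] := subquo_surj Hp s.
  have Jbx : J (rmul b x0) by apply: JM.
  have : L (p (rmul a (rmul b x0 - x))).
    by apply: LM; [apply: idealB | rewrite (subquoB Hp) // (subquoM Hp) // pb px0].
  rewrite rmulBr (subquoB Hp) //; do ?exact: JM.
  move/(left_idealBr HL0); apply; have := L1a b; rewrite /L1 /=; by rewrite rmulA.
have L1Q : prim_between I J (core L1).
  split; first exact: core_primitive.
    move=> x Ix; apply/L1E => y Jy.
    by rewrite (subquo_ker Hp (JM _ _ Jy)).2; [apply: left_ideal0 | apply: Defs.idealMr].
  move=> JQ; have [s Ls] := Lmax _ Lt0 t0; have [b Jb pb] := subquo_surj Hp s.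
  have := (L1E b).1 (JQ _ Jb) _ Jx0; rewrite (subquoM Hp) // pb px0 => Lst.
  by apply: Lt0; apply: (left_idealBr HL0 Ls).
exists (core L1) => //; apply/seteqP; split=> t; have [y Jy <-] := subquo_surj Hp t.
  move=> /(traceE L1Q Jy)/L1E Ly s; have [x Jx <-] := subquo_surj Hp s.
  by rewrite -(subquoM Hp) //; apply: Ly.
move=> Ly; apply/(traceE L1Q Jy)/L1E => x Jx.
by rewrite (subquoM Hp).
Qed.

Lemma trace_bij : bij_on (prim_between I J) (@primitive T) trace.
Proof.
have sub Q Q' : prim_between I J Q -> prim_between I J Q' ->
    trace Q = trace Q' -> Q `<=` Q'.
  move=> HQ HQ' e; have [HQ0 _ _] := HQ; have [HQ'0 _ nJQ'] := HQ'.
  apply: (primitive_sub HQ0 HQ'0 nJQ') => x [Qx Jx].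
  by apply/(traceE HQ' Jx); rewrite -e; apply/(traceE HQ Jx).
split; [exact: trace_primitive | exact: trace_surj | move=> Q Q' HQ HQ' e].
by apply/seteqP; split; apply: sub.
Qed.
End SubquotientSpectrum.

(** On traces, the inclusion of the preimage of [P] in [Q] is only tested on [J]; primeness of [Q]
    extends it to all of [R]. The condition on a layer thus becomes one on the spectra of [R] and
    [S]. *)
Lemma spectrum_preserving_between (R S T T' : rng) (f : rng_hom R S) (f' : rng_hom T T')
    (I J : ideal R) (I' J' : ideal S) (p : R -> T) (q : S -> T') :
  subquotient I J p -> subquotient I' J' q -> J `<=` f @^-1` J' ->
  (forall x, J x -> f' (p x) = q (f x)) ->
  spectrum_preserving f' <->
  bij_rel (prim_between I' J') (prim_between I J) (pre_sub f).
Proof.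
move=> Hp Hq fJ compat; rewrite spectrum_preservingE.
apply: (bij_rel_transport (trace_bij Hq) (trace_bij Hp)) => P Q HP HQ; split.
  move=> sub a Pa; have [HQ0 _ nJQ] := HQ.
  apply: (primitive_prime HQ0 nJQ) => b Jb.
  have Jab : J (rmul a b) by apply: idealMl.
  apply/(traceE Hp HQ Jab)/sub; rewrite /= compat //.
  apply/(traceE Hq HP (fJ _ Jab)); rewrite homM; case: HP => HP _ _.
  exact: primitiveMr.
move=> sub t; have [x Jx <-] := subquo_surj Hp t.
rewrite /= compat // => /(traceE Hq HP (fJ _ Jx)) Px.
by apply/(traceE Hp HQ Jx)/sub.
Qed.

(** * The twisted product [x * psi * y] *)

Section Twisted.
Variables (S : pzRingType) (psi : S).

Let mul (x y : S) : S := x * psi * y.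
Let mulA : associative mul.
Proof. by move=> x y z; rewrite /mul !mulrA. Qed.
Let mulDl : left_distributive mul +%R.
Proof. by move=> x y z; rewrite /mul !mulrDl. Qed.
Let mulDr : right_distributive mul +%R.
Proof. by move=> x y z; rewrite /mul mulrDr. Qed.

Definition twisted : rng := @Rng S mul mulA mulDl mulDr.

Let untwist_fun (x : twisted) : ring_rng S := (x : S) * psi.
Let untwist_zmod : zmod_morphism untwist_fun.
Proof. by move=> x y; apply: mulrBl. Qed.
HB.instance Definition _ :=
  GRing.isZmodMorphism.Build twisted (ring_rng S) untwist_fun untwist_zmod.
Let untwistM (x y : twisted) : untwist_fun (rmul x y) = rmul (untwist_fun x) (untwist_fun y).
Proof. by rewrite /untwist_fun /= /mul !mulrA. Qed.

Definition untwist : rng_hom twisted (ring_rng S) :=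
  @RngHom twisted (ring_rng S) (untwist_fun : {additive _ -> _}) untwistM.

Definition full := exists s : seq (S * S), 1 = \sum_(p <- s) p.1 * psi * p.2.

Definition twist_prim (P : set S) : set S := [set x | P (psi * x * psi)].

Section Full.
Hypothesis psi_full : full.

Lemma full_left_ideal (L : set (ring_rng S)) (z : S) : left_ideal L ->
  (forall b, L (psi * b * z)) -> L z.
Proof.
have [s s1] := psi_full => HL Lz; rewrite -[z]mul1r s1 mulr_suml.
apply: (left_ideal_sum HL) => -[a b] /=; rewrite -!mulrA.
by apply: (left_idealM HL a); rewrite mulrA.
Qed.

Lemma full_right (P : set (ring_rng S)) (z : S) : primitive P ->
  (forall b, P (z * b * psi)) -> P z.
Proof.
have [s s1] := psi_full => HP Pz; rewrite -[z]mulr1 s1 mulr_sumr.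
apply: (left_ideal_sum (primitive_left HP)) => -[a b] /=; rewrite !mulrA.
by apply: (primitiveMr HP).
Qed.

(** The map [x |-> psi * x] is a homomorphism from the twisted ring to [S], through which it acts on
    [M = S / L]. The submodule [psi M], nonzero by fullness, is simple with annihilator
    [twist_prim P]; the left ideal used is the annihilator of the class of [psi * v]. *)
Lemma twist_prim_primitive P :
  @primitive (ring_rng S) P -> @primitive twisted (twist_prim P).
Proof.
move=> /primitiveP[L [HL0 [x0 Lx0] Lmax] ->].
have [v Lv] : exists v : S, ~ L (psi * v).
  apply: contrapT => nex; apply: Lx0; apply: (full_left_ideal HL0) => b.
  by apply: contrapT => Lb; apply: nex; exists (b * x0); rewrite mulrA.
have LB x y : L x -> L y -> L (x - y) by apply: (left_idealB HL0).
have LM (x y : S) : L y -> L (x * y) by apply: (left_idealM HL0).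
have Lmax' x z : ~ L x -> exists a : S, L (a * x - z) by move=> /Lmax/(_ z).
have LmaxP (x z : S) : ~ L x -> exists a : S, L (psi * a * x - psi * z).
  move=> /(Lmax' _ z)[a La]; exists a.
  by rewrite -mulrA -mulrBr; apply: LM.
apply/primitiveP; exists [set x : twisted | L (psi * (x : S) * psi * v)].
  split.
  - split=> /= [|x y Lx Ly|a x Lx].
    + by rewrite mulr0 !mul0r; apply: (left_ideal0 HL0).
    + by rewrite mulrBr !mulrBl; apply: LB.
    + by rewrite /mul -!mulrA; apply/LM/LM; rewrite !mulrA.
  - have [a La] := LmaxP _ v Lv; exists a => /= Lav; apply: Lv.
    by apply: (left_idealBr HL0 La); rewrite mulrA.
  - move=> x /= Lx z; have [a La] := LmaxP _ (z * psi * v) Lx; exists a.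
    by rewrite /mul mulrBr !mulrBl; move: La; rewrite !mulrA.
apply/seteqP; split=> a /= La x.
  have := La (x * psi * v); rewrite /= /mul => H.
  by move: H; rewrite !mulrA.
have [c Lc] := Lmax' _ x Lv.
apply: (left_idealBr HL0 (x := psi * (a : S) * psi * (c * (psi * v)))).
  by rewrite -[rmul _ _]/(psi * (a : S) * psi * x) -mulrBr; apply: LM.
by have := La c; rewrite /= /mul !mulrA.
Qed.

Lemma twist_prim_surj Q : @primitive twisted Q ->
  exists2 P, @primitive (ring_rng S) P & Q = twist_prim P.
Proof.
move=> /primitiveP[L [HL0 [x0 Lx0] Lmax] ->].
have LB (x y : S) : L x -> L y -> L (x - y) by apply: (left_idealB HL0).
have LM (x y : S) : L y -> L (x * psi * y) by apply: (left_idealM HL0).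
have Lmax' (x z : S) : ~ L x -> exists a : S, L (a * psi * x - z) by move=> /Lmax/(_ z).
have L0 (u : S) : (forall z : S, L (z * psi * u)) -> L u.
  move=> Lzu; apply: contrapT => Lu; have [z Lz] := Lmax' _ u Lu.
  by apply: Lu; apply: (left_idealBr HL0 Lz).
(* [L1] is a left ideal of [S], although [L] is not. *)
pose L1 : set (ring_rng S) := [set y | forall x : S, L (x * (y : S) * psi * x0)].
have L1irr : irreducible L1.
  split.
  - split=> /= [|y z Ly Lz|a y Ly] x; rewrite /L1 /=.
    + by rewrite mulr0 !mul0r; apply: (left_ideal0 HL0).
    + by rewrite mulrBr !mulrBl; apply: LB.
    + by rewrite !mulrA.
  - exists 1 => L11; have [a La] := Lmax' _ x0 Lx0; apply: Lx0.
    by apply: (left_idealBr HL0 La); have := L11 a; rewrite mulr1.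
  - move=> y Ly z; have [x Lx] : exists x : S, ~ L (x * y * psi * x0).
      by apply: contrapT => nex; apply: Ly => x; apply: contrapT => Lx; apply: nex; exists x.
    have [s s1] := psi_full.
    have [r Lr] : {r : S -> S & forall b, L (r b * psi * (x * y * psi * x0) - b * z * psi * x0)}.
      by apply: (@choice _ _ (fun b r : S => L (r * psi * (x * y * psi * x0) - b * z * psi * x0))) => b; apply: Lmax'.
    (* With [w = x * y * psi * x0] outside of [L], each [r b] carries [w] to [b * z * psi * x0]
       modulo [L]; these solutions are glued along [1 = \sum a * psi * b]. *)
    exists (\sum_(p <- s) p.1 * psi * r p.2 * psi * x) => x'; rewrite /=.
    have -> : x' * ((\sum_(p <- s) p.1 * psi * r p.2 * psi * x) * y - z) * psi * x0 =
        \sum_(p <- s) x' * p.1 * psi * (r p.2 * psi * (x * y * psi * x0) - p.2 * z * psi * x0).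
      rewrite -[z in LHS]mul1r s1 !mulr_suml -sumrB mulr_sumr !mulr_suml.
      apply: eq_bigr => p _; rewrite !mulrBr !mulrBl !mulrA //.
    by apply: (left_ideal_sum HL0) => p; apply: LM.
exists (core L1); first exact: core_primitive.
apply/seteqP; split=> a /= La.
  move=> y x; rewrite /=.
  have -> : x * (psi * a * psi * y) * psi * x0 = x * psi * (a * psi * (y * psi * x0)).
    by rewrite !mulrA.
  by apply: LM; apply: La.
move=> x; have [y Ly] := Lmax' _ x Lx0.
apply: (left_idealBr HL0 (x := rmul a (y * psi * x0))).
  by rewrite -rmulBr; apply: LM.
apply: L0 => z; have := La y z; by rewrite /= /mul !mulrA.
Qed.

(** If the preimage of [P] is in [twist_prim P'], then [psi * a * x * b * psi] is in [P'] for all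
    [x] in [P] and all [a], [b]. Fullness removes both factors [psi], so [P] is contained in [P'],
    and the antichain condition gives equality. *)
Lemma untwist_spectrum_preserving :
  (forall P Q : set (ring_rng S), primitive P -> primitive Q -> P `<=` Q -> P = Q) ->
  spectrum_preserving untwist.
Proof.
move=> antichain; apply/spectrum_preservingE.
have sub P : @primitive (ring_rng S) P -> pre_sub untwist P (twist_prim P).
  by move=> HP x Px; rewrite /twist_prim /= -mulrA; apply: (primitiveMl HP).
have uniq P P' : @primitive (ring_rng S) P -> @primitive (ring_rng S) P' ->
    pre_sub untwist P (twist_prim P') -> P = P'.
  move=> HP HP' PP'; apply: antichain => // x Px.
  apply: (full_right HP') => b; apply: (full_left_ideal (primitive_left HP')) => a.
  have := PP' (a * x * b); rewrite /twist_prim /= /untwist_fun !mulrA; apply.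
  by rewrite -!mulrA; apply/(primitiveMl HP)/(primitiveMr HP).
split=> [P HP|Q /twist_prim_surj[P HP ->]].
  exists (twist_prim P); first by split; [apply: twist_prim_primitive | apply: sub].
  by move=> _ /twist_prim_surj[P' HP' ->] /(uniq _ _ HP HP') ->.
exists P; first by split=> //; apply: sub.
by move=> P' HP' /(uniq _ _ HP' HP).
Qed.
End Full.
End Twisted.

(** The ideal [K] generated by [psi] is proper, hence lies in a maximal left ideal [L]; since [K] is
    stable on the right, [psi] kills [S / L]. *)
Lemma not_full_primitive (S : pzRingType) (psi : S) :
  ~ full psi -> exists2 P, @primitive (ring_rng S) P & P psi.
Proof.
move=> nfull.
pose K : set S := [set x | exists s : seq (S * S), x = \sum_(p <- s) p.1 * psi * p.2].
have K0 : K 0 by exists [::]; rewrite big_nil.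
have KB x y : K x -> K y -> K (x - y).
  move=> [s ->] [t ->]; exists (s ++ [seq (- p.1, p.2) | p <- t]).
  rewrite big_cat big_map /= -sumrN; congr (_ + _).
  by apply: eq_bigr => p _; rewrite !mulNr.
have KM a x : K x -> K (a * x).
  move=> [s ->]; exists [seq (a * p.1, p.2) | p <- s].
  by rewrite big_map mulr_sumr; apply: eq_bigr => p _; rewrite !mulrA.
pose good (L : set S) := [/\ @left_ideal (ring_rng S) L, K `<=` L & ~ L 1].
have [L [[L0|[HL KL L1]] Lmax]] : exists L, (L = set0 \/ good L) /\
    forall M, L `<` M -> ~ (M = set0 \/ good M).
  apply: (@Zorn_bigcup _ (fun L => L = set0 \/ good L)) => F Fgood Ftot.
  have [[X0 FX0 gX0]|none] := pselect (exists2 X, F X & good X); last first.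
    left; apply/seteqP; split=> // x [X FX Xx].
    by case: (Fgood _ FX) => [X0|gX]; [rewrite -X0 | case: none; exists X].
  right; split.
  - split=> [|x y [X FX Xx] [Y FY Yy]|a x [X FX Xx]].
    + by exists X0 => //; case: gX0 => H _ _; apply: (left_ideal0 H).
    + have [X1 FX1 [X1x X1y]] : exists2 X1, F X1 & X1 x /\ X1 y.
        by case: (Ftot _ _ FX FY) => sub; [exists Y | exists X] => //; split=> //; apply: sub.
      case: (Fgood _ FX1) => [E|[H _ _]]; first by rewrite E in X1x.
      by exists X1 => //; apply: (left_idealB H).
    + case: (Fgood _ FX) => [E|[H _ _]]; first by rewrite E in Xx.
      by exists X => //; apply: (left_idealM H).
  - by case: gX0 => _ KX0 _ x Kx; exists X0 => //; apply: KX0.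
  - move=> [X FX X1]; case: (Fgood _ FX) => [E|[_ _]]; last exact.
    by rewrite E in X1.
- case: (Lmax K); last first.
    by right; split=> //; split.
  by rewrite L0; split=> [x|K00]; [|have := K00 _ K0].
exists (@core (ring_rng S) L).
  apply: core_primitive; split=> //; first by exists 1.
  move=> x Lx z; apply: contrapT => nz.
  (* This is [L + S x], strictly larger than [L]; if no [a] solved [a * x = z] modulo [L], it would
     avoid [1] and contradict maximality. *)
  pose M : set S := [set y | exists2 a : S, L (y - a * x) & True].
  have LB y y' : L y -> L y' -> L (y - y') by apply: (left_idealB HL).
  have LN y : L y -> L (- y) by apply: (left_idealN HL).
  have ME : L `<=` M by move=> y Ly; exists 0; rewrite ?mul0r ?subr0.
  apply: (Lmax M).
    split=> [|ML]; [exact: ME | apply/Lx/ML; exists 1 => //].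
    by rewrite mul1r subrr; apply: (left_ideal0 HL).
  right; split.
  - split=> [|y y' [a La _] [a' La' _]|b y [a La _]].
    + exact/ME/(left_ideal0 HL).
    + exists (a - a') => //.
      have -> : y - y' - (a - a') * x = (y - a * x) - (y' - a' * x).
        by rewrite mulrBl !opprB addrACA [RHS]addrACA [- y' + _]addrC.
      exact: LB.
    + by exists (b * a) => //; rewrite -mulrA -mulrBr; apply: (left_idealM HL).
  - by move=> y /KL; apply: ME.
  - move=> [a La _]; apply: nz; exists (z * a).
    rewrite -opprB; apply: LN; rewrite -[rmul _ _]mulrA -{1}[z]mulr1 -mulrBr.
    exact: (left_idealM HL).
by move=> x; apply: KL; exists [:: (1, x)]; rewrite big_seq1 mul1r.
Qed.

(** * Matrices over a commutative ring *)

Section MatrixSpectrum.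
Variables (B : comNzRingType) (d : nat).
Implicit Types P Q : set (ring_rng 'M[B]_d).

Lemma delta_mx_conj (x : 'M[B]_d) (i r s j : 'I_d) :
  delta_mx i r *m x *m delta_mx s j = x r s *: delta_mx i j.
Proof.
rewrite -(mul_delta_mx (0 : 'I_1) i r) -(mul_delta_mx (0 : 'I_1) s j).
rewrite -!mulmxA (mulmxA _ x) -rowE (mulmxA (row r x)) -colE.
have -> : col s (row r x) = (x r s)%:M by rewrite [LHS]mx11_scalar !mxE.
by rewrite mul_scalar_mx -scalemxAr mul_delta_mx.
Qed.

(** The scalar matrix of [x r s] is the sum over [i] of [delta_mx i r *m x *m delta_mx s i]. Thus
    [Q] is determined by the scalar matrices that it contains. *)
Lemma matrix_primitive_scalar Q x : primitive Q ->
  Q x <-> forall r s, Q (x r s)%:M.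
Proof.
move=> HQ; have QM (a b : 'M_d) : Q b -> Q (a *m b) by apply: (primitiveMl HQ).
have QMr (a b : 'M_d) : Q a -> Q (a *m b) by apply: (primitiveMr HQ).
have Qsum := left_ideal_sum (primitive_left HQ).
split=> [Qx r s|Qx].
  rewrite scalar_mx_sum_delta; apply: Qsum => i; rewrite -(delta_mx_conj x).
  by apply/QMr/QM.
rewrite [x]matrix_sum_delta; apply: (Qsum) => r; apply: (Qsum) => s.
by rewrite -mul_scalar_mx; apply: QMr.
Qed.

(** Suppose that a scalar [c] is in [Q] but not in [P]. Irreducibility gives a scalar [b] such that
    [b * c - 1] is in [P], hence in [Q]; so [1] is in [Q], which is absurd. *)
Lemma matrix_primitive_antichain P Q : primitive P -> primitive Q -> P `<=` Q -> P = Q.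
Proof.
move=> HP HQ PQ; apply/seteqP; split=> // x Qx; apply/matrix_primitive_scalar => // r s.
have {Qx} : Q (x r s)%:M by move/(matrix_primitive_scalar _ HQ): Qx.
move: (x r s) => c Qc; apply: contrapT => Pc.
have [L [HL _ Lmax] defP] := (primitiveP P).1 HP.
have LB y z : L y -> L z -> L (y - z) by apply: (left_idealB HL).
have LBr y z : L (y - z) -> L y -> L z by apply: (left_idealBr HL).
have LM (a y : 'M_d) : L y -> L (a *m y) by apply: (left_idealM HL).
have Lsum := left_ideal_sum HL.
have Lmax' (y z : 'M_d) : ~ L y -> exists a : 'M_d, L (a *m y - z) by move=> /Lmax/(_ z).
have [i [z Lz]] : exists i, exists z : 'M[B]_d, ~ L (c%:M *m delta_mx i i *m z).
  apply: contrapT => nex; apply: Pc; rewrite defP => z.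
  rewrite -[rmul _ _]/(c%:M *m z) -[z]mul1mx mx1_sum_delta mulmx_suml mulmx_sumr.
  apply: Lsum => i; rewrite mulmxA; apply: contrapT => Lz; apply: nex.
  by exists i, z.
have [a La] := Lmax' _ (delta_mx i i *m z) Lz.
(* Multiplying [a c w = w] modulo [L] by [delta_mx i i] on the left keeps only the entry [a i i], so
   [u w] is in [L]. As [u] is central and [w] generates the module, [u] then kills all of it. *)
pose w := delta_mx i i *m z; pose u : B := a i i * c - 1.
have Lw : ~ L w by move=> /(LM c%:M); rewrite mulmxA.
have Lu : L (u%:M *m w).
  have -> : u%:M *m w = delta_mx i i *m (a *m (c%:M *m delta_mx i i *m z) - w).
    rewrite mulmxBr /w !mul_scalar_mx -!scalemxAl -!scalemxAr !mulmxA delta_mx_conj.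
    rewrite mul_delta_mx -scalemxAl scalerA -[X in _ - X]scale1r -scalerBl.
    by rewrite mulrC.
  exact: LM.
have Pu : P u%:M.
  rewrite defP => y; have [b Lb] := Lmax' _ y Lw.
  apply: (LBr (u%:M *m (b *m w))); first by rewrite -mulmxBr; apply: LM.
  by rewrite mulmxA -scalar_mxC -mulmxA; apply: LM.
apply: (primitive_neqT HQ); apply/seteqP; split=> // y _.
have Q1 : Q 1%:M.
  have -> : 1%:M = (a i i)%:M *m c%:M - u%:M :> 'M_d.
    by rewrite -scalar_mxM -raddfB subKr.
  apply: (primitiveB HQ); last exact: PQ.
  exact: (primitiveMl HQ).
rewrite -[y]mulmx1; exact: (primitiveMl HQ).
Qed.
End MatrixSpectrum.

(** * Filtrations *)

Definition filtration (R : rng) (n : nat) (J : nat -> ideal R) :=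
  [/\ J 0%N = [set 0] :> set R, J n = [set: R] :> set R
    & forall m, (m < n)%N -> J m `<=` J m.+1].

Section Filtration.
Variables (R : rng) (n : nat) (J : nat -> ideal R).
Hypothesis HJ : filtration n J.

Lemma filtration_sub m m' : (m <= m')%N -> (m' <= n)%N -> J m `<=` J m'.
Proof.
have [_ _ Jsub] := HJ; elim: m' => [|m' IH]; first by rewrite leqn0 => /eqP-> _ x.
rewrite leq_eqVlt => /orP[/eqP-> _ x //|lt_mm'] lt_m'n.
exact: subset_trans (IH lt_mm' (ltnW lt_m'n)) (Jsub _ lt_m'n).
Qed.

Lemma primitive_layer P : primitive P ->
  exists2 m, (m < n)%N & prim_between (J m) (J m.+1) P.
Proof.
have [J0 Jn _] := HJ => HP.
have exP : exists m, `[< ~ J m `<=` P >].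
  exists n; apply/asboolP; rewrite Jn => PT; apply: (primitive_neqT HP).
  by apply/seteqP; split.
case: (ex_minnP exP) => -[|m] /asboolP nJP min_m.
  by case: nJP; rewrite J0 => _ ->; apply: primitive0.
have JmP : J m `<=` P.
  by apply: contrapT => /asboolP/min_m; rewrite ltnn.
exists m; last by split.
apply: min_m; apply/asboolP; rewrite Jn => PT; apply: (primitive_neqT HP).
by apply/seteqP; split.
Qed.

Lemma primitive_layer_uniq P m m' : (m < n)%N -> (m' < n)%N ->
  prim_between (J m) (J m.+1) P -> prim_between (J m') (J m'.+1) P -> m = m'.
Proof.
wlog lt_mm' : m m' / (m < m')%N.
  move=> W ltm ltm' Hm Hm'; case: (ltngtP m m') => // lt_mm'; first exact: W.
  by apply/esym; apply: W.
move=> ltm ltm' [_ _ nJP] [_ JP _]; case: nJP.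
by apply: (subset_trans _ JP); apply: filtration_sub => //; apply: ltnW.
Qed.
End Filtration.

(* The bijection between the primitive spectra given by the filtrations [J], [I]
   can only move primitive ideals towards higher layers of [J'], and, by
   descending induction, has no room to do so. *)
Lemma full_layers (R S : rng) (f : rng_hom R S)
    (N : nat) (J : nat -> ideal R) (I : nat -> ideal S)
    (n : nat) (J' : nat -> ideal R) (I' : nat -> ideal S) (full_layer : nat -> Prop) :
  filtration N J -> filtration N I -> filtration n J' -> filtration n I' ->
  (forall m, J' m `<=` f @^-1` I' m) ->
  (forall m, (m < N)%N -> bij_rel (prim_between (I m) (I m.+1))
     (prim_between (J m) (J m.+1)) (pre_sub f)) ->
  (forall m, (m < n)%N -> full_layer m -> bij_rel (prim_between (I' m) (I' m.+1))
     (prim_between (J' m) (J' m.+1)) (pre_sub f)) ->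
  (forall m, (m < n)%N -> ~ full_layer m ->
     exists2 P, prim_between (I' m) (I' m.+1) P & J' m.+1 `<=` f @^-1` P) ->
  forall m, (m < n)%N -> full_layer m.
Proof.
move=> HJ HI HJ' HI' fJ' bij bij' nfull.
(* The union of the bijections given by the layers of [J] and [I]; only its totality on the left and
   its injectivity are needed. *)
pose rel P Q := exists2 m, (m < N)%N & [/\ prim_between (I m) (I m.+1) P,
  prim_between (J m) (J m.+1) Q & pre_sub f P Q].
have relL P : primitive P -> exists2 Q, primitive Q & rel P Q.
  move=> /(primitive_layer HI)[m ltm Pm]; have [Q [Qm PQ] _] := (bij _ ltm).1 _ Pm.
  by exists Q; [case: Qm | exists m].
have rel_inj P P' Q : rel P Q -> rel P' Q -> P = P'.
  move=> [m ltm [Pm Qm PQ]] [m' ltm' [Pm' Qm' P'Q]].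
  have e := primitive_layer_uniq HJ ltm' ltm Qm' Qm; rewrite e in Pm'.
  have [P0 _ P0_uniq] := (bij _ ltm).2 _ Qm.
  by rewrite (P0_uniq _ Pm PQ) (P0_uniq _ Pm' P'Q).
(* Induction on a bound [c] of [n - m], that is, from the top layer downwards. *)
have rel_layer : forall c m, (m < n)%N -> (n - m <= c)%N ->
    (forall P Q, prim_between (I' m) (I' m.+1) P -> rel P Q ->
       prim_between (J' m) (J' m.+1) Q) /\ full_layer m.
  elim=> [|c IH] m ltmn; first by rewrite leqn0 subn_eq0 leqNgt ltmn.
  move=> le_c; have stay P Q : prim_between (I' m) (I' m.+1) P -> rel P Q ->
      prim_between (J' m) (J' m.+1) Q.
    move=> Pm relPQ; have [_ _ [_ [HQ _ _] PQ]] := relPQ.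
    have [l ltln Ql] := primitive_layer HJ' HQ.
    case: (ltngtP l m) => [lt_lm|lt_ml|<- //].
      (* A lower layer is excluded: [J' m] maps into [I' m], which is contained in [P], so [Q]
         contains [J' m] and hence [J' l.+1]. *)
      case: Ql => _ _ []; apply: (subset_trans (filtration_sub HJ' lt_lm (ltnW ltmn))).
      apply: (subset_trans (fJ' m)); apply: (subset_trans _ PQ) => x.
      by case: Pm => _ IP _ /IP.
    have [|stay_l full_l] := IH l ltln.
      by rewrite -ltnS; apply: leq_trans le_c; apply: ltn_sub2l.
    (* In a higher layer, already known to be full, [Q] has a partner [P'] in layer [l]. What [rel]
       associates with [P'] stays in that layer, hence is [Q], and injectivity forces [P = P'],
       although their layers differ. *)
    have [P' [P'l P'Q] _] := (bij' _ ltln full_l).2 _ Ql.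
    have [Q' HQ' relP'Q'] := relL _ (let: And3 HP' _ _ := P'l in HP').
    have Q'l := stay_l _ _ P'l relP'Q'; have [_ _ [_ _ P'Q']] := relP'Q'.
    have [Q0 _ Q0_uniq] := (bij' _ ltln full_l).1 _ P'l.
    have QQ' : Q' = Q by rewrite (Q0_uniq _ Ql P'Q) (Q0_uniq _ Q'l P'Q').
    rewrite QQ' in relP'Q'.
    rewrite -(rel_inj _ _ _ relPQ relP'Q') in P'l.
    by move: lt_ml; rewrite (primitive_layer_uniq HI' ltmn ltln Pm P'l) ltnn.
  split=> //; apply: contrapT => /(nfull _ ltmn)[P Pm JP].
  have [Q HQ relPQ] := relL _ (let: And3 HP _ _ := Pm in HP).
  have [_ _ []] := stay _ _ Pm relPQ; have [_ _ [_ _ PQ]] := relPQ.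
  exact: subset_trans JP PQ.
by move=> m ltmn; case: (rel_layer _ m ltmn (leqnn _)).
Qed.

(** * Concrete presentations of subquotients *)

Section Presentations.
Variables (R S : rng) (q : rng_hom R S) (q_surj : forall y, exists x, q x = y).
Variables (I J : ideal R).
Hypothesis q_ker : forall x, q x = 0 <-> I x.

Definition to_image (x : R) : sub_rng (image_ideal J q_surj) :=
  insubd (0 : sub_rng (image_ideal J q_surj)) (q x).

Lemma val_to_image x : J x -> val (to_image x) = q x.
Proof. by move=> Jx; apply: insubdK; apply/ideal_predP; exists x. Qed.

Lemma to_image_subquotient : subquotient I J to_image.
Proof.
split=> [x y Jx Jy|x y Jx Jy|t|x Jx].
- apply: val_inj; rewrite raddfB /= !val_to_image ?raddfB //.
  exact: idealB.
- apply: val_inj; rewrite /= !val_to_image ?homM //.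
  exact: idealMl.
- have [x Jx qx] := ideal_predP _ _ (valP t); exists x => //.
  by apply: val_inj; rewrite val_to_image.
- rewrite -q_ker -val_to_image //; split=> [-> //|e].
  exact: val_inj.
Qed.
End Presentations.

Lemma subquotient_iso (R T T' : rng) (I J : ideal R) (p : R -> T) (g : {additive T -> T'}) h :
  cancel g h -> cancel h g -> (forall x y, g (rmul x y) = rmul (g x) (g y)) ->
  subquotient I J p -> subquotient I J (g \o p).
Proof.
move=> gK hK gM Hp; split=> [x y Jx Jy|x y Jx Jy|t|x Jx] /=.
- by rewrite (subquoB Hp) ?raddfB.
- by rewrite (subquoM Hp).
- by have [x Jx px] := subquo_surj Hp (h t); exists x; rewrite //= px hK.
- rewrite -(subquo_ker Hp Jx); split=> [|->]; last exact: raddf0.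
  by rewrite -(raddf0 g); apply: (can_inj gK).
Qed.

Lemma quo_pi_ker (R : rng) (I : ideal R) x : quo_pi I x = 0 <-> I x.
Proof. by rewrite -(raddf0 (quo_pi I)) quo_eqP subr0. Qed.

Lemma spectrum_preserving_subquo (R S : rng) (f : rng_hom R S) (I J : ideal R)
    (I' J' : ideal S) (fI : I `<=` f @^-1` I') (fJ : J `<=` f @^-1` J') :
  spectrum_preserving (subquo_hom fI fJ) <->
  bij_rel (prim_between I' J') (prim_between I J) (pre_sub f).
Proof.
apply: (spectrum_preserving_between
  (to_image_subquotient (@quo_pi_surj R I) J (@quo_pi_ker R I))
  (to_image_subquotient (@quo_pi_surj S I') J' (@quo_pi_ker S I'))) => // x Jx.
apply: val_inj; rewrite val_to_image /=; last exact: fJ.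
by rewrite [sval _](val_to_image (@quo_pi_surj R I) Jx); apply: quo_mapE.
Qed.

(** * Affine cellular algebras *)

Section IdempotentCellIdeal.
Variables (k : comNzRingType) (A : algType k) (i : involution A).
Variables (J : ideal (ring_rng A)) (D : cell_datum i J).

(** Under [alpha], products become [X *m psi *m Y]. Idempotence applied to the preimage of the
    identity matrix expresses [1] through [psi]; conversely, multiplying such an expression by [X]
    on the left decomposes any [X]. *)
Lemma idempotent_cell_ideal :
  idempotent_ideal J <-> @full 'M[cd_B D]_(cd_rank D) (cd_psi D).
Proof.
pose to_J (x : A) : ideal_sub J := insubd (0 : ideal_sub J) x.
have to_JK x : J x -> val (to_J x) = x by move=> /ideal_predP Jx; apply: insubdK.
have valJ (x : ideal_sub J) : J (val x) by apply/ideal_predP/valP.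
split.
  move=> JJ; have : J (val (cd_alphaV D 1%:M)) by [].
  rewrite -{1}JJ => -[s sJ e].
  exists [seq (cd_alpha D (to_J p.1), cd_alpha D (to_J p.2)) | p <- s].
  rewrite -[LHS](cd_alphaVK (c := D)) big_map.
  have -> : cd_alphaV D 1 = \sum_(p <- s) sub_mul (to_J p.1) (to_J p.2).
    apply: val_inj; rewrite raddf_sum /= [LHS]e big_seq [RHS]big_seq.
    by apply: eq_bigr => p /sJ[Jp1 Jp2]; rewrite !to_JK.
  by rewrite raddf_sum; apply: eq_bigr => p _; rewrite cd_alphaM.
move=> [s s1]; apply/seteqP; split=> [_ [t tJ ->]|x Jx].
  rewrite big_seq; elim/big_ind: _ => [||p /tJ[Jp1 _]].
  - exact: ideal0.
  - by move=> u v; apply: idealD.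
  - exact: Defs.idealMr.
pose X := cd_alpha D (to_J x).
exists [seq (val (cd_alphaV D (X *m p.1)), val (cd_alphaV D p.2)) | p <- s].
  by move=> _ /mapP[p _ ->]; split; apply: valJ.
rewrite big_map -[LHS]to_JK //.
have -> : to_J x = \sum_(p <- s) sub_mul (cd_alphaV D (X *m p.1)) (cd_alphaV D p.2).
  apply: (can_inj (@cd_alphaK _ _ _ _ D)); rewrite raddf_sum -[LHS]mulmx1.
  rewrite [1%:M]s1 mulmx_sumr; apply: eq_bigr => p _.
  by rewrite cd_alphaM !cd_alphaVK !mulmxA.
by rewrite raddf_sum.
Qed.
End IdempotentCellIdeal.

Section AsymptoticFiltration.
Variables (k : comNzRingType) (A : algType k) (i : involution A).
Variable C : affine_cellular i.
Local Notation n := (chain_len C).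
Local Notation layer_mx j := 'M[cd_B (cell_data (a := C) j)]_(cd_rank (cell_data j)).

(** The product of the first [m] factors, embedded in the asymptotic algebra by zeros. *)
Definition asym_set (m : nat) : set (ring_rng (asym C)) :=
  [set x | forall l : 'I_n, (m <= l)%N -> (x : asym C) l = 0].

Fact asym_set0 m : asym_set m 0. Proof. by []. Qed.
Fact asym_setB m x y : asym_set m x -> asym_set m y -> asym_set m (x - y).
Proof.
move=> x0 y0 l le_ml.
by rewrite -[LHS]/((x : asym C) l - (y : asym C) l) x0 // y0 // subrr.
Qed.
Fact asym_setMl m a x : asym_set m x -> asym_set m (rmul a x).
Proof.
move=> x0 l le_ml.
by rewrite -[LHS]/((a : asym C) l * (x : asym C) l) x0 // mulr0.
Qed.
Fact asym_setMr m a x : asym_set m x -> asym_set m (rmul x a).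
Proof.
move=> x0 l le_ml.
by rewrite -[LHS]/((x : asym C) l * (a : asym C) l) x0 // mul0r.
Qed.
Definition asym_ideal m : ideal (ring_rng (asym C)) :=
  Ideal (@asym_set0 m) (@asym_setB m) (@asym_setMl m) (@asym_setMr m).

Lemma chain_filtration : filtration n (chain C).
Proof.
split=> [||m ltmn].
- rewrite chainE; apply/seteqP; split=> x.
    by move=> [y _ ->]; rewrite big_pred0.
  move=> ->; exists [ffun=> 0] => [j|]; first by rewrite ffunE; apply: chain_comp0.
  by rewrite big_pred0.
- apply/seteqP; split=> // x _; rewrite chainE.
  have [y [[Cy ->] _]] := chain_direct C x; exists y => //.
  by apply: eq_bigl => j; rewrite ltn_ord.
- by have [] := chain_strict (Ordinal ltmn).
Qed.

Lemma asym_filtration : filtration n asym_ideal.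
Proof.
split=> [||m ltmn].
- apply/seteqP; split=> x /= x0; last by rewrite x0.
  by apply: functional_extensionality_dep => l; apply: x0.
- by apply/seteqP; split=> // x _ l; rewrite leqNgt ltn_ord.
- by move=> x x0 l lt_ml; apply/x0/ltnW.
Qed.

Lemma alg_pi_ker (j : 'I_n) x : alg_pi (chain_pideal j) x = 0 <-> chain C j x.
Proof.
by have := @alg_pi_eqP _ _ (chain_pideal j) x 0; rewrite raddf0 subr0.
Qed.

Lemma theta_chain m : chain C m `<=` theta C @^-1` asym_ideal m.
Proof.
move=> x Cx l le_ml; rewrite -[LHS]/(theta_fun (C := C) x l) /theta_fun.
have -> : ideal_lmul (alg_pi (chain_pideal l) x) (cell_e (C := C) l) = 0.
  apply: val_inj; rewrite /=.
  have -> : @alg_pi_fun _ _ (chain_pideal l) x = 0; last exact: mul0r.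
  apply/(alg_pi_ker l x).
  exact: (filtration_sub chain_filtration le_ml (ltnW (ltn_ord l))).
exact: raddf0.
Qed.

Definition to_layer (j : 'I_n) : A -> twisted (cell_psi j) :=
  (cd_alpha (cell_data j) : {additive _ -> twisted (cell_psi j)}) \o
  to_image (@alg_pi_surj _ A (chain_pideal j)) (chain C j.+1).

Lemma to_layer_subquotient (j : 'I_n) :
  @subquotient (ring_rng A) _ (chain C j) (chain C j.+1) (to_layer j).
Proof.
apply: subquotient_iso (to_image_subquotient _ _ (alg_pi_ker j)).
- exact: (@cd_alphaK _ _ _ _ (cell_data j)).
- exact: (@cd_alphaVK _ _ _ _ (cell_data j)).
- exact: cd_alphaM.
Qed.

Definition asym_proj (j : 'I_n) (x : asym C) : ring_rng (layer_mx j) := x j.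

Lemma asym_proj_subquotient (j : 'I_n) :
  @subquotient (ring_rng (asym C)) _ (asym_ideal j) (asym_ideal j.+1) (@asym_proj j).
Proof.
split=> // [t|x Jx].
  pose y : asym C := dfwith (fun l => 0 : layer_mx l) t.
  have yj : y j = t by apply: dfwith_in.
  exists y => // l lt_jl; apply: dfwith_out.
  by apply: contraTneq lt_jl => <-; rewrite ltnn.
split=> [xj l|x0]; last exact: x0.
by rewrite leq_eqVlt => /orP[/eqP/val_inj<-|/Jx].
Qed.

(** For [x] in the layer, [alpha (x e_j)] is [alpha x *m psi *m alpha e_j], and [alpha e_j] is the
    identity matrix. *)
Lemma untwist_to_layer (j : 'I_n) x : chain C j.+1 x ->
  untwist (cell_psi j) (to_layer j x) = asym_proj j (theta C x).
Proof.
move=> Cx; rewrite -[RHS]/(theta_fun (C := C) x j) /theta_fun.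
set y := to_image (@alg_pi_surj _ A (chain_pideal j)) (chain C j.+1) x.
have -> : ideal_lmul (alg_pi (chain_pideal j) x) (cell_e (C := C) j) = sub_mul y (cell_e (C := C) j).
  by rewrite /sub_mul val_to_image.
by rewrite cd_alphaM cd_alphaVK mulmx1.
Qed.

Lemma full_bij_rel (j : 'I_n) : full (cell_psi j) ->
  bij_rel (prim_between (asym_ideal j) (asym_ideal j.+1))
    (prim_between (chain C j) (chain C j.+1)) (pre_sub (theta C)).
Proof.
move=> fullj; apply/(spectrum_preserving_between (to_layer_subquotient j)
  (asym_proj_subquotient j) (@theta_chain j.+1) (@untwist_to_layer j)).
by apply: untwist_spectrum_preserving => //; apply: matrix_primitive_antichain.
Qed.

(** On [chain C j.+1] the component [j] of [theta] is a left multiple of [psi], hence falls in any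
    primitive ideal of the factor that contains [psi]. *)
Lemma not_full_layer (j : 'I_n) : ~ full (cell_psi j) ->
  exists2 P, prim_between (asym_ideal j) (asym_ideal j.+1) P
    & chain C j.+1 `<=` theta C @^-1` P.
Proof.
move=> /not_full_primitive[P HP Ppsi].
have [Q HQ defP] := trace_surj (asym_proj_subquotient j) HP.
exists Q => // x Cx; apply/(traceE (asym_proj_subquotient j) HQ (theta_chain Cx)).
rewrite -untwist_to_layer // defP.
exact: (primitiveMl HP).
Qed.
End AsymptoticFiltration.

Theorem theoremC (k : idomainType) (k_noetherian : noetherian k)
    (A : algType k) (i : involution A) (C : affine_cellular i)
    (psi_regular : forall j : 'I_(chain_len C), ~ zero_divisor (\det (cell_psi j))%R) :
  weakly_spectrum_preserving (theta C) <->
  forall j : 'I_(chain_len C), idempotent_ideal (layer j).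
Proof.
split=> [[N [J [I [fJ [HJ HI sp]]]]] j|idem].
  apply/(idempotent_cell_ideal (cell_data j)).
  (* The quantification over [l] gives a predicate on all of [nat], while [cell_psi] is only defined
     on ordinals. *)
  pose full_layer m := forall l : 'I_(chain_len C), l = m :> nat -> full (cell_psi l).
  apply: (full_layers (full_layer := full_layer) HJ HI (chain_filtration C)
    (asym_filtration C) (@theta_chain _ _ _ C)) (ltn_ord j) j erefl => [m ltm|m ltm full_m|m ltm nfull].
  - by apply/(spectrum_preserving_subquo (fJ m) (fJ m.+1)); apply: sp.
  - exact: (@full_bij_rel _ _ _ _ (Ordinal ltm) (full_m (Ordinal ltm) erefl)).
  - apply: (@not_full_layer _ _ _ _ (Ordinal ltm)) => full_m; apply: nfull => l e.
    by have -> : l = Ordinal ltm by apply: val_inj.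
(* Conversely, the cell chain and the partial products of factors are suitable filtrations. *)
exists (chain_len C), (chain C), (@asym_ideal _ _ _ C), (@theta_chain _ _ _ C).
split; [exact: chain_filtration | exact: asym_filtration | move=> m ltm].
apply/spectrum_preserving_subquo/(@full_bij_rel _ _ _ _ (Ordinal ltm)).
exact/(idempotent_cell_ideal (cell_data (Ordinal ltm))).
Qed.
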